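(* Let $\ell$ be a classification loss function with Lipschitz constant $L_{\mathrm{Lip}}$ and $\ell(\cdot,\cdot)\in[0,1]$. Then, with probability at least $1-\delta$ over the samples $\mathcal D_{\mathrm{train}}$, $$\mathbb E_{\mathcal G\sim\mathcal D}\big[\ell(\mathcal G,\hat\theta_{\mathrm{aug}})\big]-\mathbb E_{\mathcal G\sim\mathcal D}\big[\ell(\mathcal G,\theta_\star)\big]\le 2\mathcal R(\ell_{\mathrm{aug}})+5\sqrt{\frac{2\log(4/\delta)}{N}}+2L_{\mathrm{Lip}}\,\mathbb E_{\mathcal G\sim\mathcal D,\ \widetilde{\mathcal G}\sim A_\lambda}\big[\|\widetilde{\mathcal G}-\mathcal G\|\big].$$ Moreover, $$\mathcal R(\ell_{\mathrm{aug}})\le\mathcal R(\ell)+\max_{n}L_{\mathrm{Lip}}\,\mathbb E_{\widetilde{\mathcal G}_n^m\sim A_\lambda}\big[\|\widetilde{\mathcal G}_n^m-\mathcal G_n\|\big].$$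
   Context: $\mathcal D$ is the distribution of graphs and $\mathcal D_{\mathrm{train}}=\{(\mathcal G_n,y_n)\}_{n=1}^N$ is a training set of labelled graphs sampled from it. $f(\cdot,\theta)$ is a graph neural network with parameter $\theta$ in a hypothesis class $\Theta$, and $\ell(\mathcal G,\theta)$ abbreviates the loss $\ell(f(\mathcal G,\theta),y)$ of a graph with label $y$. $\|\cdot\|$ is a norm on the graph input space (a finite-dimensional real vector space of adjacency and feature matrices, the number of nodes being bounded), and $L_{\mathrm{Lip}}$ is the Lipschitz constant of the loss with respect to the input graph in this norm. An augmentation generator $A_\lambda$, deterministic or stochastic, with parameter $\lambda$, maps $(\mathcal G_n,y_n)$ to an augmented labelled graph; $\widetilde{\mathcal G}_n^m\sim A_\lambda$ denotes an augmented graph, with label $\tilde y_n^m$, sampled from $A_\lambda(\mathcal G_n,y_n)$, and similarly $\widetilde{\mathcal G}\sim A_\lambda$ denotes an augmentation of $\mathcal G$; $M$ augmented graphs are generated per training graph. The augmented loss is $\ell_{\mathrm{aug}}(\mathcal G_n,\theta)=\mathbb E_{\widetilde{\mathcal G}_n^m\sim A_\lambda}[\ell(f(\widetilde{\mathcal G}_n^m,\theta),\tilde y_n^m)]$. Parameters: $\theta_\star=\arg\min_\theta\mathcal L_\theta$ is the optimal parameter of the non-augmented setting, where $\mathcal L_\theta=\frac1N\sum_{n=1}^N\ell(f(\mathcal G_n,\theta),y_n)$ is the classical training loss. The optimal parameter of the augmented setting is $\theta_{\mathrm{aug}}=\arg\min_\theta\frac1N\sum_{n=1}^N\ell_{\mathrm{aug}}(\mathcal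 G_n,\theta)$, and $\hat\theta_{\mathrm{aug}}$ is its empirical estimate $\hat\theta_{\mathrm{aug}}=\arg\min_\theta\frac1{NM}\sum_{n=1}^N\sum_{m=1}^M\ell(\widetilde{\mathcal G}_n^m,\theta)$. The Rademacher complexity is $\mathcal R(\ell)=\mathbb E_{\epsilon}\big[\sup_{\theta\in\Theta}\big|\frac1N\sum_{n=1}^N\epsilon_n\ell(\mathcal G_n,\theta)\big|\big]$ with $\epsilon_n$ independent and equal to $\pm1$ with equal probability; $\mathcal R(\ell_{\mathrm{aug}})$ is the same with $\ell_{\mathrm{aug}}$ in place of $\ell$.
   Formalization: For a stochastic generator the first bound is proved only for M ≥ some M0 (all M ≥ 1 if deterministic), as it fails for fixed M; and if augmentation changes labels, L_Lip is also assumed to bound the loss change between a labelled graph and its augmentation. *)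

(* Defs.v *)
From HB Require Import structures.
From mathcomp Require Import all_boot all_order all_algebra.
From mathcomp Require Import all_classical all_reals all_analysis.

Set Implicit Arguments.
Unset Strict Implicit.
Unset Printing Implicit Defensive.
Import Order.TTheory GRing.Theory Num.Theory.
Import numFieldNormedType.Exports.
Local Open Scope classical_set_scope.
Local Open Scope ring_scope.

(* The graph input space is a finite-dimensional normed space V (pairs of an
   adjacency and a feature matrix, say), with its Borel sigma-algebra. *)
Notation borel_space V := (g_sigma_algebraType (@open V)).

(* A labelled graph z is the pair of a graph z.1 and of its label z.2. *)
Notation labelled V Y := (borel_space V * Y)%type.

Definition finite_dimensional (R : realType) (V : normedModType R) : Prop :=
  exists (k : nat) (e : 'I_k -> V),
    forall v : V, exists c : 'I_k -> R, v = \sum_(i < k) c i *: e i.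

(* Finitely many classes, every set of classes being measurable. *)
Definition finite_discrete d (Y : measurableType d) : Prop :=
  finite_set [set: Y] /\ forall B : set Y, measurable B.

Section losses.
Context (R : realType) (V : normedModType R) (d : measure_display)
  (Y : measurableType d) (O Theta : Type).

Definition graph_dist (z z' : labelled V Y) : R := `|(z.1 : V) - (z'.1 : V)|.

Variables (f : V -> Theta -> O) (l : O -> Y -> R).

Definition loss (z : labelled V Y) (t : Theta) : R := l (f z.1 t) z.2.

Variable A : R.-pker (labelled V Y) ~> (labelled V Y).

Definition loss_aug (z : labelled V Y) (t : Theta) : R :=
  \int[A z]_z' loss z' t.

(* A Lipschitz bound in the graph alone cannot compare losses computed with
   unrelated labels, so two kinds of pairs are compared: graphs with a common
   label, and a labelled graph with its augmentations, whose label A may change.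
   The second clause follows from the first when A keeps labels. *)
Definition lipschitz_loss (L : R) : Prop :=
  (forall (t : Theta) (y : Y), L.-lipschitz (fun G : V => l (f G t) y : R^o)) /\
  (forall (t : Theta) (z : labelled V Y),
     {ae A z, forall z', `|loss z' t - loss z t| <= L * graph_dist z' z}).

Definition deterministic : Prop :=
  forall z, exists a, forall C, measurable C -> A z C = \d_a C :> \bar R.

Variable D : probability (labelled V Y) R.

Definition risk (t : Theta) : R := \int[D]_z loss z t.

(* E_{G ~ D, G~ ~ A}[ ||G~ - G|| ]; it may be +oo. *)
Definition mean_displacement : \bar R :=
  (\int[D]_z \int[A z]_z' (graph_dist z' z)%:E)%E.

(* Joint law of the N training points Z and of the M augmentations Zt of each
   of them: the Z n are iid of law D and, conditionally on them, the Zt n m are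
   independent, Zt n m having law A (Z n). *)
Definition augmented_sample (N M : nat) d' (Omega : measurableType d')
    (P : probability Omega R) (Z : 'I_N -> Omega -> labelled V Y)
    (Zt : 'I_N -> 'I_M -> Omega -> labelled V Y) : Prop :=
  [/\ forall n, measurable_fun setT (Z n),
      forall n m, measurable_fun setT (Zt n m) &
      forall (B : 'I_N -> set (labelled V Y))
             (C : 'I_N -> 'I_M -> set (labelled V Y)),
        (forall n, measurable (B n)) -> (forall n m, measurable (C n m)) ->
        P [set w | forall n, B n (Z n w) /\ forall m, C n m (Zt n m w)] =
        \big[mule/1%E]_(n < N)
          (\int[D]_(z in B n) \big[mule/1%E]_(m < M) A z (C n m))%E].

End losses.

Definition is_argmin (R : realType) (T : Type) (g : T -> R) (t : T) : Prop :=
  forall t', g t <= g t'.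

(* 1/N \sum_n l(G_n, t) *)
Definition train_loss (R : realType) (V : normedModType R) d
    (Y : measurableType d) (O Theta : Type) (f : V -> Theta -> O)
    (l : O -> Y -> R) (N : nat) (z : 'I_N -> labelled V Y) (t : Theta) : R :=
  N%:R^-1 * \sum_(n < N) loss f l (z n) t.

(* 1/(NM) \sum_n \sum_m l(G~_n^m, t) *)
Definition train_loss_aug (R : realType) (V : normedModType R) d
    (Y : measurableType d) (O Theta : Type) (f : V -> Theta -> O)
    (l : O -> Y -> R) (N M : nat) (zt : 'I_N -> 'I_M -> labelled V Y)
    (t : Theta) : R :=
  (N * M)%:R^-1 * \sum_(n < N) \sum_(m < M) loss f l (zt n m) t.

(* Rademacher complexity of the family g(z_n, .) at the points z_n; the signs
   (-1)^eps_n, for eps uniform on {0,1}^N, are iid uniform on {-1,1}. *)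
Definition rademacher (R : realType) (T Theta : Type) (g : T -> Theta -> R)
    (N : nat) (z : 'I_N -> T) : R :=
  (2 ^+ N)^-1 * \sum_(eps : {ffun 'I_N -> bool})
    sup (range (fun t => `|N%:R^-1 * \sum_(n < N) (-1) ^+ eps n * g (z n) t|)).

(* Q contains an event of probability at least p; Q itself need not be
   measurable, as it may quantify over uncountably many parameters. *)
Definition with_probability (R : realType) d (Omega : measurableType d)
    (P : probability Omega R) (p : R) (Q : Omega -> Prop) : Prop :=
  exists E : set Omega,
    [/\ measurable E, (p%:E <= P E)%E & forall w, E w -> Q w].

(* Main.v *)
Require Import Defs.
From HB Require Import structures.
From mathcomp Require Import all_boot all_order all_algebra.
From mathcomp Require Import all_classical all_reals all_analysis.
From mathcomp Require Import measurable_realfun ring lra.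
Set Implicit Arguments.
Unset Strict Implicit.
Unset Printing Implicit Defensive.
Import Order.TTheory GRing.Theory Num.Theory.
Import numFieldNormedType.Exports.
Local Open Scope classical_set_scope.
Local Open Scope ring_scope.

(* Write h_t for the augmented loss of t. The parameter theta_aug_hat is compared
   with a fixed near-minimizer t0 of the risk, not with theta_star: then only the
   one-sided deviation sup_t (E h_t - mean of h_t) has to be uniform in t, which
   is what leaves 2 R(l_aug) rather than 4 R(l_aug). Symmetrization bounds its
   mean, and one application of the bounded differences inequality to
     sup_t (E h_t - mean of h_t) + (mean of h_t0 - E h_t0) - 2 R(l_aug),
   whose mean is nonpositive, costs 4 of the 5 square root terms. The last one
   absorbs all the approximations below.

   The parameter space carries no structure, but the losses are equi-Lipschitz on
   a separable space, so they are nearly constant, uniformly in t, on the cells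
   of a countable partition, of which finitely many carry almost all the mass.
   Hence h_t(z) depends, up to a small error, on the finitely many numbers
   A z (cell) only. Quantizing them reduces the deviation inequality to iid
   points of a finite set, where every expectation is a finite sum and the
   supremum over t raises no measurability issue. In the same way the mean of the
   losses of the M augmentations of z is close to h_t(z), uniformly in t, as soon
   as the empirical frequencies of the cells are close to A z (cell); the variance
   k (1 - k) / M in Chebyshev's inequality vanishes if A is deterministic. *)

(** * Concentration over finite probability spaces *)

Section iid_mean.
Context (R : realType) (S : finType) (p : S -> R).
Hypotheses (p_ge0 : forall a, 0 <= p a) (p_sum1 : \sum_a p a = 1).

Definition iid_mean n (F : {ffun 'I_n -> S} -> R) : R :=
  \sum_(s : {ffun 'I_n -> S}) (\prod_i p (s i)) * F s.

Definition bounded_differences n (c : R) (F : {ffun 'I_n -> S} -> R) : Prop :=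
  forall (i : 'I_n) (s s' : {ffun 'I_n -> S}),
    (forall j, j != i -> s j = s' j) -> `|F s - F s'| <= c.

Definition fcons n (a : S) (s : {ffun 'I_n -> S}) : {ffun 'I_n.+1 -> S} :=
  [ffun i => if unlift ord0 i is Some j then s j else a].

Lemma fcons0 n a (s : {ffun 'I_n -> S}) : fcons a s ord0 = a.
Proof. by rewrite ffunE unlift_none. Qed.

Lemma fcons_lift n a (s : {ffun 'I_n -> S}) j : fcons a s (lift ord0 j) = s j.
Proof. by rewrite ffunE liftK. Qed.

Lemma sum_fcons n (H : {ffun 'I_n.+1 -> S} -> R) :
  \sum_s H s = \sum_a \sum_(s : {ffun 'I_n -> S}) H (fcons a s).
Proof.
rewrite pair_big (reindex (fun x : S * {ffun 'I_n -> S} => fcons x.1 x.2)) //=.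
exists (fun s : {ffun 'I_n.+1 -> S} => (s ord0, [ffun j => s (lift ord0 j)])).
- move=> [a s] _ /=; rewrite fcons0; congr (_, _).
  by apply/ffunP => j; rewrite ffunE fcons_lift.
- move=> s _ /=; apply/ffunP => i.
  case: (unliftP ord0 i) => [j|] ->; last by rewrite fcons0.
  by rewrite fcons_lift ffunE.
Qed.

Lemma iid_meanS n (F : {ffun 'I_n.+1 -> S} -> R) :
  iid_mean F = \sum_a p a * iid_mean (fun s => F (fcons a s)).
Proof.
rewrite /iid_mean sum_fcons; apply: eq_bigr => a _; rewrite mulr_sumr.
apply: eq_bigr => s _; rewrite big_ord_recl fcons0 -mulrA; congr (_ * (_ * _)).
by apply: eq_bigr => i _; rewrite fcons_lift.
Qed.

Lemma iid_weight_ge0 n (s : {ffun 'I_n -> S}) : 0 <= \prod_i p (s i).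
Proof. exact: prodr_ge0. Qed.

Lemma iid_weight_sum n : \sum_(s : {ffun 'I_n -> S}) \prod_i p (s i) = 1.
Proof. by rewrite -(bigA_distr_bigA (fun=> p)) big1. Qed.

Lemma iid_mean_cst n c : iid_mean (fun _ : {ffun 'I_n -> S} => c) = c.
Proof. by rewrite /iid_mean -mulr_suml iid_weight_sum mul1r. Qed.

Lemma le_iid_mean n (F G : {ffun 'I_n -> S} -> R) :
  (forall s, F s <= G s) -> iid_mean F <= iid_mean G.
Proof.
by move=> FG; apply: ler_sum => s _; rewrite ler_wpM2l ?iid_weight_ge0.
Qed.

Lemma eq_iid_mean n (F G : {ffun 'I_n -> S} -> R) :
  F =1 G -> iid_mean F = iid_mean G.
Proof. by move=> FG; apply: eq_bigr => s _; rewrite FG. Qed.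

Lemma iid_meanD n (F G : {ffun 'I_n -> S} -> R) :
  iid_mean (fun s => F s + G s) = iid_mean F + iid_mean G.
Proof. by rewrite /iid_mean -big_split; apply: eq_bigr => s _; rewrite mulrDr. Qed.

Lemma iid_meanZ n k (F : {ffun 'I_n -> S} -> R) :
  iid_mean (fun s => k * F s) = k * iid_mean F.
Proof. by rewrite /iid_mean mulr_sumr; apply: eq_bigr => s _; rewrite mulrCA. Qed.

Lemma iid_mean_sum n (I : finType) (F : I -> {ffun 'I_n -> S} -> R) :
  iid_mean (fun s => \sum_i F i s) = \sum_i iid_mean (F i).
Proof.
by rewrite /iid_mean exchange_big; apply: eq_bigr => s _; rewrite mulr_sumr.
Qed.

Lemma iid_mean_coord n (i : 'I_n) (f : S -> R) :
  iid_mean (fun s => f (s i)) = \sum_a p a * f a.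
Proof.
rewrite /iid_mean.
transitivity (\prod_(j < n) \sum_a (p a * (if j == i then f a else 1))).
  rewrite bigA_distr_bigA; apply: eq_bigr => s _.
  rewrite big_split /=; congr (_ * _).
  by rewrite (bigD1 i) //= eqxx big1 ?mulr1 // => j /negPf ->.
rewrite (bigD1 i) //= [X in _ * X]big1 ?mulr1.
  by apply: eq_bigr => a _; rewrite eqxx.
by move=> j /negPf ji; under eq_bigr do rewrite ji mulr1.
Qed.

(* [e^x <= (1 - x/4)^-4], and the latter is compared with the quadratic. *)
Lemma expR_le_quadratic (x : R) : `|x| <= 2^-1 -> expR x <= 1 + x + x ^+ 2.
Proof.
rewrite ler_norml => /andP[x1 x2].
have q1 : 0 < 1 - x / 4 by lra.
have eq4 : (1 - x / 4) <= expR (- (x / 4)) by exact: expR_ge1Dx.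
have -> : expR x = (expR (- (x / 4)) ^+ 4)^-1.
  rewrite -expRM_natl -expRN; congr expR.
  by field.
have e4 : (1 - x / 4) ^+ 4 <= expR (- (x / 4)) ^+ 4.
  by rewrite lerXn2r // nnegrE ?expR_ge0 // ltW.
have q4 : 0 < (1 - x / 4) ^+ 4 by rewrite exprn_gt0.
apply: le_trans (_ : ((1 - x / 4) ^+ 4)^-1 <= _).
  by rewrite lef_pV2 // posrE exprn_gt0 // expR_gt0.
rewrite -[X in X <= _]mul1r ler_pdivrMr //.
have -> : (1 + x + x ^+ 2) * (1 - x / 4) ^+ 4 =
    1 + x ^+ 2 * (3/8 - 11/16 * x + 81/256 * x ^+ 2 - 15/256 * x ^+ 3 + x ^+ 4 / 256).
  by field.
rewrite lerDl; apply: mulr_ge0; first exact: sqr_ge0.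
have x30 : x ^+ 3 <= 2^-1 * x ^+ 2 by rewrite exprS ler_wpM2r ?sqr_ge0.
have x40 : 0 <= x ^+ 4 by rewrite -[4%N]/(2 * 2)%N exprM sqr_ge0.
have : 0 <= x ^+ 2 by exact: sqr_ge0.
lra.
Qed.

Lemma centered_le (X : S -> R) c a :
  (forall b, `|X a - X b| <= c) -> `|X a - \sum_b p b * X b| <= c.
Proof.
move=> Xc; have -> : X a - \sum_b p b * X b = \sum_b p b * (X a - X b).
  by under [RHS]eq_bigr do rewrite mulrBr; rewrite sumrB -mulr_suml p_sum1 mul1r.
apply: le_trans (ler_norm_sum _ _ _) _.
rewrite -[c]mul1r -p_sum1 mulr_suml; apply: ler_sum => b _.
by rewrite normrM ger0_norm // ler_wpM2l.
Qed.

(* The variance is half the mean of [(X - X')^2], [X'] an independent copy. *)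
Lemma variance_le (X : S -> R) c :
  (forall a b, `|X a - X b| <= c) ->
  \sum_a p a * (X a - \sum_b p b * X b) ^+ 2 <= c ^+ 2 / 2.
Proof.
move=> Xc; set m := \sum_b p b * X b.
have m0 : \sum_a p a * (X a - m) = 0.
  by under eq_bigr do rewrite mulrBr; rewrite sumrB -mulr_suml p_sum1 mul1r subrr.
have -> : \sum_a p a * (X a - m) ^+ 2 =
    (\sum_a \sum_b p a * (p b * (X a - X b) ^+ 2)) / 2.
  have E a : \sum_b p a * (p b * (X a - X b) ^+ 2) =
      p a * (X a - m) ^+ 2 + p a * (\sum_b p b * (X b - m) ^+ 2).
    rewrite -mulr_sumr -mulrDr; congr (_ * _).
    transitivity (\sum_b (p b * (X a - m) ^+ 2 + p b * (X b - m) ^+ 2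
        - 2 * (X a - m) * (p b * (X b - m)))).
      by apply: eq_bigr => b _; ring.
    by rewrite sumrB big_split /= -mulr_suml p_sum1 mul1r -mulr_sumr m0 mulr0 subr0.
  under [in RHS]eq_bigr do rewrite E.
  by rewrite big_split /= -mulr_suml p_sum1 mul1r; field.
rewrite ler_pM2r // -[c ^+ 2]mul1r -p_sum1 mulr_suml; apply: ler_sum => a _.
rewrite -mulr_sumr ler_wpM2l // -[c ^+ 2]mul1r -p_sum1 mulr_suml.
apply: ler_sum => b _; rewrite ler_wpM2l // -real_normK ?num_real //.
by rewrite lerXn2r // nnegrE // (le_trans _ (Xc a b)).
Qed.

(** A form of Hoeffding's lemma: in the quadratic bound on the exponential the linear term vanishes
    by centering and the other one is the variance. The restriction [u * c <= 2^-1] keeps the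
    exponent in the range of that bound. *)
Lemma mgf_le (X : S -> R) (c u : R) :
  0 <= u -> u * c <= 2^-1 -> (forall a b, `|X a - X b| <= c) ->
  \sum_a p a * expR (u * (X a - \sum_b p b * X b)) <= expR (u ^+ 2 * c ^+ 2 / 2).
Proof.
move=> u0 uc Xc; set m := \sum_b p b * X b.
have m0 : \sum_a p a * (X a - m) = 0.
  by under eq_bigr do rewrite mulrBr; rewrite sumrB -mulr_suml p_sum1 mul1r subrr.
apply: le_trans (expR_ge1Dx _).
apply: (@le_trans _ _
    (\sum_a p a * (1 + u * (X a - m) + (u * (X a - m)) ^+ 2))).
  apply: ler_sum => a _; rewrite ler_wpM2l // expR_le_quadratic //.
  rewrite normrM ger0_norm //; apply: le_trans uc.
  by rewrite ler_wpM2l // centered_le.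
have -> : \sum_a p a * (1 + u * (X a - m) + (u * (X a - m)) ^+ 2) =
    1 + u ^+ 2 * \sum_a p a * (X a - m) ^+ 2.
  transitivity (\sum_a (p a + u * (p a * (X a - m))
      + u ^+ 2 * (p a * (X a - m) ^+ 2))); first by apply: eq_bigr => a _; ring.
  by rewrite !big_split /= -!mulr_sumr p_sum1 m0 mulr0 addr0.
by rewrite lerD2l -mulrA ler_wpM2l ?sqr_ge0 // variance_le.
Qed.

(** Induction on the number of coordinates, conditioning on the first one: the conditional mean [G]
    inherits the oscillation bound [c] and contributes one factor through [mgf_le]; the other
    coordinates contribute theirs by induction. *)
Lemma bounded_differences_mgf n (c u : R) (F : {ffun 'I_n -> S} -> R) :
  0 <= u -> u * c <= 2^-1 -> bounded_differences c F ->
  iid_mean (fun s => expR (u * (F s - iid_mean F))) <=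
    expR (n%:R * (u ^+ 2 * c ^+ 2 / 2)).
Proof.
move=> u0 uc; elim: n F => [|n IH] F Fc.
  rewrite mul0r expR0 (_ : (fun _ => _) = fun=> 1) ?iid_mean_cst //.
  apply/funext => s; suff -> : F = fun=> F s.
    by rewrite iid_mean_cst subrr mulr0 expR0.
  by apply/funext => s'; congr F; apply/ffunP => -[].
pose G a := iid_mean (fun s => F (fcons a s)).
have GE : iid_mean F = \sum_a p a * G a by rewrite iid_meanS.
have Gc a b : `|G a - G b| <= c.
  have -> : G a - G b = iid_mean (fun s => F (fcons a s) - F (fcons b s)).
    by rewrite iid_meanD -(mulN1r (G b)) -iid_meanZ; congr (_ + _);
       apply: eq_iid_mean => s; rewrite mulN1r.
  rewrite /iid_mean; apply: le_trans (ler_norm_sum _ _ _) _.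
  rewrite -[c](iid_mean_cst n); apply: ler_sum => s _.
  rewrite normrM ger0_norm ?iid_weight_ge0 // ler_wpM2l ?iid_weight_ge0 //.
  apply: (Fc ord0) => j; case: (unliftP ord0 j) => [k|] ->; last by rewrite eqxx.
  by rewrite !fcons_lift.
rewrite iid_meanS GE.
apply: (@le_trans _ _ (\sum_a p a * (expR (u * (G a - \sum_b p b * G b)) *
    expR (n%:R * (u ^+ 2 * c ^+ 2 / 2))))).
  apply: ler_sum => a _; rewrite ler_wpM2l //.
  rewrite (@eq_iid_mean _ _ (fun s => expR (u * (G a - \sum_b p b * G b)) *
     expR (u * (F (fcons a s) - G a)))); last first.
    by move=> s; rewrite -expRD -mulrDr; congr (expR (_ * _)); ring.
  rewrite iid_meanZ ler_wpM2l ?expR_ge0 // IH // => i s s' ss'.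
  apply: (Fc (lift ord0 i)) => j.
  case: (unliftP ord0 j) => [k|] ->; last by rewrite !fcons0.
  by rewrite (inj_eq lift_inj) => /ss'; rewrite !fcons_lift.
under eq_bigr do rewrite mulrA.
rewrite -mulr_suml (_ : n.+1%:R * _ = u ^+ 2 * c ^+ 2 / 2 +
  n%:R * (u ^+ 2 * c ^+ 2 / 2)); last by rewrite -(natr1 n); ring.
by rewrite expRD ler_wpM2r ?expR_ge0 // mgf_le.
Qed.

Definition iid_prob n (Q : pred {ffun 'I_n -> S}) : R := iid_mean (fun s => (Q s)%:R).

(** Chernoff's bound: the indicator of the event is at most [expR (u * (F s - iid_mean F - v))]. The
    choice of [u] is left to the caller. *)
Lemma bounded_differences_tail n (c u v : R) (F : {ffun 'I_n -> S} -> R) :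
  0 <= u -> u * c <= 2^-1 -> bounded_differences c F ->
  iid_prob (fun s => iid_mean F + v <= F s) <=
    expR (n%:R * (u ^+ 2 * c ^+ 2 / 2) - u * v).
Proof.
move=> u0 uc Fc; rewrite expRD -(ler_pdivrMr _ _ (expR_gt0 _)) -expRN opprK.
apply: le_trans (bounded_differences_mgf u0 uc Fc).
rewrite mulrC -iid_meanZ; apply: le_iid_mean => s.
case: (boolP (_ + v <= F s)) => [Fs|_]; last by rewrite mulr0n mulr0 expR_ge0.
by rewrite mulr1n mulr1 ler_expR ler_wpM2l //; lra.
Qed.

End iid_mean.

Section sup_range.
Context (R : realType) (I : Type).
Implicit Types X : I -> R.

Lemma sup_range_ub X B i : (forall j, X j <= B) -> X i <= sup (range X).
Proof.
by move=> XB; apply: ub_le_sup; [exists B => _ [j _ <-]|exists i].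
Qed.

Lemma sup_range_le X B (i0 : I) : (forall j, X j <= B) -> sup (range X) <= B.
Proof. by move=> XB; apply: ge_sup => [|_ [j _ <-]//]; exists (X i0), i0. Qed.

End sup_range.

(** * Empirical means and Rademacher complexity *)

Section empirical_means.
Context (R : realType) (S Theta : Type) (h : S -> Theta -> R).
Hypothesis h01 : forall a t, 0 <= h a t <= 1.
Variables (N : nat) (N_gt0 : (0 < N)%N).

Definition sample_mean (s : 'I_N -> S) (t : Theta) : R :=
  N%:R^-1 * \sum_(n < N) h (s n) t.

Definition signed_mean (e : 'I_N -> bool) (s : 'I_N -> S) (t : Theta) : R :=
  N%:R^-1 * \sum_(n < N) (-1) ^+ e n * h (s n) t.

Lemma mean_le (x : 'I_N -> R) c : (forall n, x n <= c) -> N%:R^-1 * \sum_n x n <= c.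
Proof.
move=> xc; rewrite ler_pdivrMl ?ltr0n //.
rewrite mulr_natl (_ : c *+ N = \sum_(n < N) c); last by rewrite sumr_const card_ord.
exact: ler_sum.
Qed.

Lemma norm_mean_le (x : 'I_N -> R) c :
  (forall n, `|x n| <= c) -> `|N%:R^-1 * \sum_n x n| <= c.
Proof.
move=> xc; rewrite normrM ger0_norm ?invr_ge0 ?ler0n //.
apply: le_trans (mean_le xc).
by rewrite ler_wpM2l ?invr_ge0 ?ler0n ?ler_norm_sum.
Qed.

Lemma sample_mean01 s t : 0 <= sample_mean s t <= 1.
Proof.
rewrite mean_le => [|n]; last by case/andP: (h01 (s n) t).
by rewrite andbT mulr_ge0 ?invr_ge0 ?ler0n ?sumr_ge0 // => n _; case/andP: (h01 (s n) t).
Qed.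

Lemma norm_signed_mean_le1 e s t : `|signed_mean e s t| <= 1.
Proof.
apply: norm_mean_le => n; rewrite normrM normr_sign mul1r ger0_norm //;
by case/andP: (h01 (s n) t).
Qed.

Lemma rademacher_ge0 (s : 'I_N -> S) : 0 <= rademacher h s.
Proof.
rewrite mulr_ge0 ?invr_ge0 ?exprn_ge0 // sumr_ge0 // => e _.
have [[t _]|T0] := pselect ([set: Theta] !=set0).
  apply: le_trans (normr_ge0 (signed_mean e s t)) _.
  exact: (sup_range_ub _ (norm_signed_mean_le1 e s)).
(* Without parameters the range is empty, and [sup] of the empty set is 0 by convention. *)
by rewrite [X in sup X](_ : _ = set0) ?sup0 // -subset0 => x [t _ _]; apply: T0; exists t.
Qed.

Lemma sample_mean_change i (s s' : 'I_N -> S) t :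
  (forall j, j != i -> s j = s' j) -> sample_mean s t <= sample_mean s' t + N%:R^-1.
Proof.
move=> ss'; rewrite -lerBlDl -mulrBr -sumrB (bigD1 i) //= big1 => [|j /ss' ->]; last exact: subrr.
rewrite addr0 -[leRHS]mulr1 ler_wpM2l ?invr_ge0 ?ler0n //.
by have := h01 (s i) t; have := h01 (s' i) t; lra.
Qed.

End empirical_means.

(** For all signs and parameters, the signed means differ by at most the average of the [c n].
    Allowing two families at two samples covers a change of one point, the quantization of the
    losses, and the passage from [loss] to [loss_aug]. *)
Lemma rademacher_le (R : realType) (T T' Theta : Type) (h : T -> Theta -> R)
    (h' : T' -> Theta -> R) (N : nat) (z : 'I_N -> T) (z' : 'I_N -> T')
    (c : 'I_N -> R) (t0 : Theta) :
  (0 < N)%N -> (forall a t, 0 <= h' a t <= 1) ->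
  (forall n t, `|h (z n) t - h' (z' n) t| <= c n) ->
  rademacher h z <= rademacher h' z' + N%:R^-1 * \sum_n c n.
Proof.
move=> N0 h'01 hh'; rewrite /rademacher -ler_pdivlMl ?invr_gt0 ?exprn_gt0 // invrK.
rewrite mulrDr mulrA mulfV ?mul1r ?expf_neq0 ?pnatr_eq0 //.
set C := N%:R^-1 * _.
have -> : 2 ^+ N * C = \sum_(e : {ffun 'I_N -> bool}) C.
  by rewrite sumr_const card_ffun card_bool card_ord -[RHS]mulr_natl natrX.
rewrite -big_split; apply: ler_sum => e _ /=; apply: (sup_range_le t0) => t.
have := sup_range_ub t (norm_signed_mean_le1 h'01 N0 e z'); rewrite /signed_mean => ub.
rewrite -lerBlDr; apply: le_trans ub; rewrite lerBlDr -lerBlDl.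
apply: le_trans (lerB_dist _ _) _; rewrite -mulrBr -sumrB normrM.
rewrite ger0_norm ?invr_ge0 ?ler0n // ler_wpM2l ?invr_ge0 ?ler0n //.
apply: le_trans (ler_norm_sum _ _ _) _; apply: ler_sum => n _.
by rewrite -mulrBr normrM normr_sign mul1r.
Qed.

(** * Symmetrization and concentration of the uniform deviation *)

Section uniform_deviation.
Context (R : realType) (S : finType) (p : S -> R).
Hypotheses (p_ge0 : forall a, 0 <= p a) (p_sum1 : \sum_a p a = 1).
Context (Theta : Type) (h : S -> Theta -> R).
Hypothesis h01 : forall a t, 0 <= h a t <= 1.
Variables (N : nat) (N_gt0 : (0 < N)%N).
Implicit Types s : {ffun 'I_N -> S}.

Let mu t : R := \sum_a p a * h a t.

Let mu01 t : 0 <= mu t <= 1.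
Proof.
rewrite sumr_ge0 => [|a _]; last by rewrite mulr_ge0 //; case/andP: (h01 a t).
by rewrite -p_sum1 ler_sum // => a _; rewrite ler_piMr //; case/andP: (h01 a t).
Qed.

Definition worst_deviation s : R :=
  sup (range (fun t => \sum_a p a * h a t - sample_mean h s t)).

Lemma worst_deviation_ub s t : mu t - sample_mean h s t <= worst_deviation s.
Proof.
apply: (@sup_range_ub _ _ (fun t => mu t - sample_mean h s t) 1) => t'.
by have := mu01 t'; have := sample_mean01 h01 N_gt0 s t'; lra.
Qed.

Let iid_mean_sample_mean t : iid_mean p (fun s => sample_mean h s t) = mu t.
Proof.
rewrite iid_meanZ iid_mean_sum.
under eq_bigr do rewrite (iid_mean_coord p_sum1 _ (h^~ t)).
by rewrite sumr_const card_ord -[mu t *+ N]mulr_natl mulrA mulVf ?mul1r // pnatr_eq0 -lt0n.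
Qed.

Definition swap (e : {ffun 'I_N -> bool}) (x : {ffun 'I_N -> S} * {ffun 'I_N -> S}) :=
  ([ffun n => if e n then x.2 n else x.1 n],
   [ffun n => if e n then x.1 n else x.2 n]).

Lemma swapK e : involutive (swap e).
Proof.
by move=> [s s']; congr (_, _); apply/ffunP => n; rewrite !ffunE /=; case: (e n).
Qed.

(* Symmetrization: exchanging the points of a sample and of a ghost sample
   wherever [e n] holds does not change their joint law. *)
Lemma mean_worst_deviation_le (t0 : Theta) :
  iid_mean p worst_deviation <= 2 * iid_mean p (fun s => rademacher h s).
Proof.
pose rho (e : {ffun 'I_N -> bool}) s := sup (range (fun t => `|signed_mean h e s t|)).
have rhoub (e : {ffun 'I_N -> bool}) s t : `|signed_mean h e s t| <= rho e s.
  exact: (sup_range_ub _ (norm_signed_mean_le1 h01 N_gt0 e s)).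
pose G s s' := sup (range (fun t => sample_mean h s' t - sample_mean h s t)).
have Gub s s' t : sample_mean h s' t - sample_mean h s t <= G s s'.
  apply: (@sup_range_ub _ _ (fun t => sample_mean h s' t - sample_mean h s t) 1) => t'.
  by have := sample_mean01 h01 N_gt0 s t'; have := sample_mean01 h01 N_gt0 s' t'; lra.
(* [mu t] is the mean of [sample_mean] over a ghost sample [s'], and a supremum of means is at most
   the mean of the suprema. *)
have step1 s : worst_deviation s <= iid_mean p (G s).
  apply: (sup_range_le t0) => t; rewrite -/(mu t) -iid_mean_sample_mean.
  rewrite -[X in _ - X](iid_mean_cst p_sum1 N) -mulN1r -iid_meanZ -iid_meanD.
  by apply: le_iid_mean => // s'; rewrite mulN1r.
(* The bound holds for every fixed sign pattern [e]; averaging over [e] afterwards produces the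
   Rademacher complexity. *)
have step2 e : iid_mean p worst_deviation <= 2 * iid_mean p (rho e).
  apply: (le_trans (le_iid_mean p_ge0 step1)).
  pose w (x : {ffun 'I_N -> S} * {ffun 'I_N -> S}) :=
    (\prod_i p (x.1 i)) * \prod_i p (x.2 i).
  have dbl H : iid_mean p (fun s => iid_mean p (H s)) = \sum_x w x * H x.1 x.2.
    rewrite /iid_mean [RHS](eq_bigr (fun x : {ffun 'I_N -> S} * {ffun 'I_N -> S} =>
       (\prod_i p (x.1 i)) *
       ((\prod_i p (x.2 i)) * H x.1 x.2))) => [|x _]; last by rewrite mulrA.
    rewrite -(pair_bigA _ (fun s s' : {ffun 'I_N -> S} => (\prod_i p (s i)) *
       ((\prod_i p (s' i)) * H s s'))) /=.
    by apply: eq_bigr => s _; rewrite mulr_sumr.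
  rewrite dbl (reindex_inj (inv_inj (swapK e))) /=.
  apply: (@le_trans _ _ (\sum_x w x * (rho e x.1 + rho e x.2))).
    apply: ler_sum => x _.
    have -> : w (swap e x) = w x.
      rewrite /w -!big_split; apply: eq_bigr => n _ /=.
      by rewrite !ffunE; case: (e n) => //; rewrite mulrC.
    rewrite ler_wpM2l //; first by rewrite mulr_ge0 // prodr_ge0.
    apply: (sup_range_le t0) => t.
    (* A swap at [n] reverses the sign of the [n]-th difference, which is the factor
       [(-1) ^+ e n]. *)
    have -> : sample_mean h (swap e x).2 t - sample_mean h (swap e x).1 t =
        signed_mean h e x.2 t - signed_mean h e x.1 t.
      rewrite -!mulrBr -!sumrB; congr (_ * _); apply: eq_bigr => n _ /=.
      by rewrite !ffunE; case: (e n); rewrite /= ?expr0 ?expr1; ring.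
    apply: le_trans (ler_norm _) _; apply: le_trans (ler_normB _ _) _.
    by rewrite addrC lerD.
  rewrite -(dbl (fun s s' => rho e s + rho e s')).
  rewrite (@eq_iid_mean _ _ _ _ _ (fun s => rho e s + iid_mean p (rho e))).
    by rewrite iid_meanD iid_mean_cst // mulr_natl mulr2n.
  by move=> s; rewrite iid_meanD iid_mean_cst.
have -> : iid_mean p (fun s => rademacher h s) = (2 ^+ N)^-1 * \sum_e iid_mean p (rho e).
  by rewrite -iid_mean_sum -iid_meanZ.
rewrite mulrCA ler_pdivlMl ?exprn_gt0 // [leRHS]mulr_sumr.
have -> : 2 ^+ N * iid_mean p worst_deviation =
    \sum_(e : {ffun 'I_N -> bool}) iid_mean p worst_deviation.
  by rewrite sumr_const card_ffun card_bool card_ord -[RHS]mulr_natl natrX.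
exact: ler_sum.
Qed.

Definition excess (t0 : Theta) s : R :=
  worst_deviation s + sample_mean h s t0 - \sum_a p a * h a t0 - 2 * rademacher h s.

Lemma mean_excess_le0 t0 : iid_mean p (excess t0) <= 0.
Proof.
rewrite (@eq_iid_mean _ _ _ _ _ (fun s => worst_deviation s + (sample_mean h s t0
  + (- mu t0 + -2 * rademacher h s)))); last by move=> s; rewrite /excess -/(mu t0); ring.
rewrite !iid_meanD iid_mean_sample_mean iid_mean_cst // iid_meanZ.
by have := mean_worst_deviation_le t0; lra.
Qed.

(** Changing one point moves the worst deviation and the sample mean at [t0] by at most [1 / N]
    each, and twice the Rademacher complexity by at most [2 / N]. *)
Lemma excess_bounded_differences t0 : bounded_differences (4 / N%:R) (excess t0).
Proof.
suff le4 i s s' : (forall j, j != i -> s j = s' j) ->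
    excess t0 s <= excess t0 s' + 4 / N%:R.
  move=> i s s' ss'; rewrite ler_norml.
  have := le4 i s s' ss'; have := le4 i s' s (fun j ji => esym (ss' j ji)); lra.
move=> ss'; have s's j : j != i -> s' j = s j by move=> /ss'.
have dev : worst_deviation s <= worst_deviation s' + N%:R^-1.
  apply: (sup_range_le t0) => t; have := worst_deviation_ub s' t.
  by have := sample_mean_change h01 t s's; rewrite /mu; lra.
have rad : rademacher h s' <= rademacher h s + N%:R^-1.
  have h's n t : `|h (s' n) t - h (s n) t| <= (n == i)%:R.
    have [->|/s's ->] := eqVneq n i; last by rewrite subrr normr0.
    by rewrite mulr1n ler_norml; have := h01 (s i) t; have := h01 (s' i) t; lra.
  apply: le_trans (rademacher_le t0 N_gt0 h01 h's) _.
  by rewrite (bigD1 i) //= eqxx big1 ?addr0 ?mulr1 // => j /negbTE ->.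
have := sample_mean_change h01 t0 ss'.
move: dev rad; rewrite /excess; lra.
Qed.

(** The exponential bound is available only for thresholds [v <= 2], but the excess never exceeds 2,
    so larger thresholds are never reached. *)
Lemma excess_tail t0 (b : R) : 0 < b < 1 ->
  iid_prob p (fun s => 4 * Num.sqrt (2 * ln b^-1 / N%:R) <= excess t0 s) <= b.
Proof.
move=> /andP[b0 b1]; set v := 4 * _.
have lnb : 0 <= ln b^-1 by rewrite ln_ge0 // invf_ge1 // ltW.
have N0 : 0 < N%:R :> R by rewrite ltr0n.
have v0 : 0 <= v by rewrite mulr_ge0 // sqrtr_ge0.
have v2 : v ^+ 2 * N%:R = 32 * ln b^-1.
  rewrite exprMn sqr_sqrtr; last by rewrite divr_ge0 ?mulr_ge0 // ltW.
  by field; rewrite gt_eqF.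
have [v_le2|v_gt2] := leP v 2.
  (* [u = v * N / 16] minimizes the exponent [N * u ^+ 2 * c ^+ 2 / 2 - u * v] for [c = 4 / N]; the
     minimum [- v ^+ 2 * N / 32] equals [- ln b^-1]. *)
  have u0 : 0 <= v * N%:R / 16 by rewrite divr_ge0 // mulr_ge0 // ltW.
  have uc : v * N%:R / 16 * (4 / N%:R) <= 2^-1.
    rewrite (_ : _ * _ = v / 4); last by field; rewrite gt_eqF.
    lra.
  apply: le_trans (_ : iid_prob p (fun s => iid_mean p (excess t0) + v <= excess t0 s) <= _).
    apply: le_iid_mean => // s; rewrite ler_nat.
    case: (boolP (v <= _)) => // vs; rewrite (le_trans _ vs) //.
    by have := mean_excess_le0 t0; lra.
  apply: le_trans (bounded_differences_tail p_ge0 p_sum1 v u0 uc (excess_bounded_differences t0)) _.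
  rewrite (_ : _ - _ = - (v ^+ 2 * N%:R / 32)); last by field; rewrite gt_eqF.
  rewrite v2 (_ : 32 * _ / 32 = ln b^-1); last by field.
  by rewrite lnV ?posrE // opprK lnK.
rewrite /iid_prob (@eq_iid_mean _ _ _ _ _ (fun=> 0)) ?iid_mean_cst ?ltW // => s.
rewrite leNgt (_ : excess t0 s < v) //.
have dev : worst_deviation s <= 1.
  apply: (sup_range_le t0) => t; rewrite -/(mu t).
  by have := mu01 t; have := sample_mean01 h01 N_gt0 s t; lra.
have := rademacher_ge0 h01 N_gt0 s.
have := mu01 t0; rewrite /mu; have := sample_mean01 h01 N_gt0 s t0.
by rewrite /excess; lra.
Qed.

End uniform_deviation.

(** * Probability measures and finite partitions *)

(** The integral of a nonnegative function is a supremum over the simple functions below it, hence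
    monotone without measurability. This serves for the mean displacement under [A z], whose
    measurability in [z] is not established. *)
Lemma ge0_le_integral_nonmeasurable d (T : measurableType d) (R : realType)
    (mu : {measure set T -> \bar R}) (f1 f2 : T -> \bar R) :
  (forall x, 0 <= f1 x)%E -> (forall x, f1 x <= f2 x)%E ->
  (\int[mu]_x f1 x <= \int[mu]_x f2 x)%E.
Proof.
move=> f10 f12; rewrite !ge0_integralTE // => [|x]; last exact: le_trans (f12 x).
by apply: ereal_sup_le => _ [g /= gf1 <-]; exists g => //= x; exact: le_trans (f12 x).
Qed.

Section bounded_Rintegral.
Context d (T : measurableType d) (R : realType) (mu : {measure set T -> \bar R}).
Hypothesis mu1 : mu setT = 1%E.
Implicit Types (f g : T -> R) (B : set T).

Lemma mass_fin_num B : measurable B -> mu B \is a fin_num.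
Proof.
move=> mB; rewrite ge0_fin_numE //; apply: (@le_lt_trans _ _ (mu setT)).
  by apply: le_measure; rewrite ?inE.
by rewrite mu1 ltry.
Qed.

Lemma mass01 B : measurable B -> 0 <= fine (mu B) <= 1.
Proof.
move=> mB; rewrite fine_ge0 //= -lee_fin fineK ?mass_fin_num // -mu1.
by apply: le_measure; rewrite ?inE.
Qed.

Lemma bounded_integrable f c : measurable_fun setT f ->
  (forall x, `|f x| <= c) -> mu.-integrable setT (EFin \o f).
Proof.
move=> mf fc; apply: measurable_bounded_integrable => //; first by rewrite mu1 ltry.
by exists c; split; [exact: num_real|move=> M /ltW cM x _ /=; exact: le_trans (fc x) cM].
Qed.

Lemma unit_integrable f : measurable_fun setT f -> (forall x, 0 <= f x <= 1) ->
  mu.-integrable setT (EFin \o f).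
Proof.
move=> mf f01; apply: (@bounded_integrable _ 1) => // x.
by rewrite ger0_norm; case/andP: (f01 x).
Qed.

Lemma Rintegral01 f : measurable_fun setT f -> (forall x, 0 <= f x <= 1) ->
  0 <= \int[mu]_x f x <= 1.
Proof.
move=> mf f01; rewrite Rintegral_ge0 => [|x _]; last by case/andP: (f01 x).
rewrite (_ : 1 = \int[mu]_x (cst 1) x :> R); last first.
  by rewrite Rintegral_cst // mu1 mulr1.
apply: le_Rintegral => //; [exact: unit_integrable| |by move=> x _; case/andP: (f01 x)].
by apply: unit_integrable => // x; rewrite ler01 lexx.
Qed.

Lemma dist_Rintegral_le f g c B :
  measurable_fun setT f -> measurable_fun setT g ->
  (forall x, 0 <= f x <= 1) -> (forall x, 0 <= g x <= 1) ->
  measurable B -> 0 <= c -> (forall x, ~ B x -> `|f x - g x| <= c) ->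
  `|\int[mu]_x f x - \int[mu]_x g x| <= c + fine (mu B).
Proof.
move=> mf mg f01 g01 mB c0 fgc.
have intf := unit_integrable mf f01; have intg := unit_integrable mg g01.
have fg1 x : `|f x - g x| <= 1.
  by rewrite ler_norml; have := f01 x; have := g01 x; lra.
rewrite -RintegralB //; apply: le_trans (le_normr_Rintegral _ _) _ => //.
  by apply: (@bounded_integrable _ 1) => //; exact: measurable_funB.
have -> : c + fine (mu B) = \int[mu]_x (c + \1_B x).
  have intB : mu.-integrable setT (EFin \o (\1_B : T -> R)).
    by apply: unit_integrable => // x; rewrite indicE; case: (_ \in _); rewrite ?lexx ?ler01.
  rewrite RintegralD //; last first.
    by apply: (@bounded_integrable _ `|c|) => // x.
  rewrite (_ : \int[mu]_x c = \int[mu]_x (cst c) x) // Rintegral_cst // mu1 mulr1.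
  by rewrite /Rintegral integral_indic // setIT.
apply: le_Rintegral => //.
- apply: (@bounded_integrable _ 1) => [|x]; last by rewrite normr_id.
  by apply: measurableT_comp => //; exact: measurable_funB.
- apply: (@bounded_integrable _ (c + 1)) => [|x].
    by apply: measurable_funD => //; exact: measurable_indic.
  by rewrite indicE ger0_norm ?addr_ge0 ?ler0n // lerD2l (ler_nat _ _ 1) leq_b1.
- move=> x _; rewrite indicE; have [xB|xB] := boolP (x \in B).
    by rewrite (le_trans (fg1 x)) // lerDr.
  by rewrite addr0 fgc // => /mem_set; exact/negP.
Qed.

Lemma Rintegral_finite_range (S : finType) (e : T -> S) (y : S -> R) :
  (forall s, measurable (e @^-1` [set s])) ->
  measurable_fun setT (y \o e) /\
  \int[mu]_x y (e x) = \sum_s y s * fine (mu (e @^-1` [set s])).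
Proof.
move=> me.
have E : y \o e = fun x => \sum_s y s * \1_(e @^-1` [set s]) x.
  apply/funext => x /=; rewrite (bigD1 (e x)) //= big1 => [|s sx].
    by rewrite indicE mem_set // mulr1 addr0.
  by rewrite indicE memNset ?mulr0 // => /= /esym; exact/eqP.
have ms s : measurable_fun setT (fun x => y s * \1_(e @^-1` [set s]) x).
  by apply: measurable_funM => //; exact: measurable_indic.
split; first by rewrite E; exact: measurable_sum.
rewrite (_ : (fun x => y (e x)) = y \o e) // E /Rintegral.
under eq_integral do rewrite -sumEFin.
have ints s : mu.-integrable setT (fun x => (y s * \1_(e @^-1` [set s]) x)%:E).
  apply: (@bounded_integrable _ `|y s|) => // x.
  by rewrite normrM indicE; case: (_ \in _); rewrite ?normr1 ?normr0 ?mulr1 ?mulr0.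
rewrite integral_sum // -sum_fine => [|s _]; last exact: integrable_fin_num.
apply: eq_bigr => s _; rewrite -/(Rintegral mu setT (fun x => y s * \1_(e @^-1` [set s]) x)).
rewrite RintegralZl //; first by rewrite /Rintegral integral_indic // setIT.
apply: (@bounded_integrable _ 1); first exact: measurable_indic.
by move=> x; rewrite indicE; case: (_ \in _); rewrite ?normr1 ?normr0.
Qed.

Lemma sum_fibre_mass (S : finType) (e : T -> S) :
  (forall s, measurable (e @^-1` [set s])) ->
  \sum_s fine (mu (e @^-1` [set s])) = 1.
Proof.
move=> me; have [_] := Rintegral_finite_range (fun=> 1) me.
rewrite (_ : (fun=> 1) = cst 1) // Rintegral_cst // mu1 mulr1 => ->.
by apply: eq_bigr => s _; rewrite mul1r.
Qed.

End bounded_Rintegral.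

(* An arbitrary value of [f] when the fibre over [s] is empty. *)
Definition fibre_value d (T : measurableType d) (S : Type) (R : Type)
    (e : T -> S) (f : T -> R) (s : S) : R := f (xget point [set z | e z = s]).

Lemma fibre_valueP d (T : measurableType d) (S R : Type) (e : T -> S) (f : T -> R) z :
  exists2 z', e z' = e z & fibre_value e f (e z) = f z'.
Proof.
exists (xget point [set z' | e z' = e z]) => //.
by have /(xgetPex point) : exists z', [set z' | e z' = e z] z' by exists z.
Qed.

(** The code of [z] records which grid values [j / m] are at most [k i z], that is, each [k i z]
    rounded down to the grid. Such thresholds make the fibres finite intersections of measurable
    sets. The index [j = m] is reached when [k i z = 1]. *)
Lemma quantization d (T : measurableType d) (R : realType) (I : finType)
    (k : I -> T -> R) (m : nat) : (0 < m)%N ->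
  (forall i, measurable_fun setT (k i)) -> (forall i z, 0 <= k i z <= 1) ->
  exists (S : finType) (q : T -> S), (forall s, measurable (q @^-1` [set s])) /\
    forall z z', q z = q z' -> forall i, `|k i z - k i z'| <= m%:R^-1.
Proof.
move=> m0 mk k01; have m0R : 0 < m%:R :> R by rewrite ltr0n.
pose q z := [ffun x : I * 'I_m.+1 => x.2%:R / m%:R <= k x.1 z].
exists {ffun I * 'I_m.+1 -> bool}, q; split=> [s|z z' qz].
  rewrite (_ : q @^-1` _ = \bigcap_(x in [set: I * 'I_m.+1])
      [set z | (x.2%:R / m%:R <= k x.1 z) = s x]); last first.
    apply/seteqP; split=> [z /= <- x _|z zs]; first by rewrite /= ffunE.
    by apply/ffunP => x; rewrite ffunE; exact: zs.
  apply: fin_bigcap_measurable => // x _.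
  have mx : measurable [set z | x.2%:R / m%:R <= k x.1 z].
    rewrite (_ : mkset _ = k x.1 @^-1` `[x.2%:R / m%:R, +oo[%classic).
      by rewrite -[X in measurable X]setTI; apply: mk.
    by apply/seteqP; split=> z /=; rewrite in_itv /= andbT.
  case: (s x); first exact: mx.
  rewrite (_ : mkset _ = ~` [set z | x.2%:R / m%:R <= k x.1 z]); first exact: measurableC.
  by apply/seteqP; split=> z /= => [->|/negP/negbTE].
suff half u v : q u = q v -> forall i, k i v <= k i u + m%:R^-1.
  by move=> i; rewrite ler_norml; have := half _ _ qz i; have := half _ _ (esym qz) i; lra.
move=> uv i; have /andP[kv0 kv1] := k01 i v.
(* [j / m] is the last grid point not above [k i v]; equal codes place it below [k i u] as well, and
   [k i v < (j + 1) / m]. *)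
pose j := Num.truncn (m%:R * k i v).
have mk0 : 0 <= m%:R * k i v by rewrite mulr_ge0 // ltW.
have /andP[jle jlt] := truncn_itv mk0.
have jm : (j < m.+1)%N.
  rewrite ltnS -(ler_nat R) (le_trans jle) // ler_piMr // ltW //.
have /ffunP/(_ (i, Ordinal jm)) := uv; rewrite !ffunE /=.
rewrite [X in _ = X](_ : _ = true) => [ku|]; last by rewrite ler_pdivrMr // mulrC.
rewrite -lerBlDr; apply: le_trans (_ : j%:R / m%:R <= _); last by rewrite ku.
rewrite ler_pdivlMr // mulrBl mulVf ?gt_eqF // lerBlDr natr1 mulrC ltW //.
Qed.

(** Peeling off the first coordinate, the cross terms vanish because [X] is centred. *)
Lemma iid_variance (R : realType) (S : finType) (p X : S -> R) n :
  \sum_a p a = 1 -> \sum_a p a * X a = 0 ->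
  iid_mean p (fun s : {ffun 'I_n -> S} => (\sum_i X (s i)) ^+ 2) =
    n%:R * \sum_a p a * X a ^+ 2.
Proof.
move=> p1 pX; set v := \sum_a p a * X a ^+ 2.
have mean0 m : iid_mean p (fun s : {ffun 'I_m -> S} => \sum_i X (s i)) = 0.
  rewrite iid_mean_sum big1 // => i _; by rewrite iid_mean_coord.
elim: n => [|n IH].
  rewrite mul0r (@eq_iid_mean _ _ _ _ _ (fun=> 0)) ?iid_mean_cst // => s.
  by rewrite big_ord0 expr0n.
rewrite iid_meanS (eq_bigr (fun a => p a * X a ^+ 2 + p a * (n%:R * v))) => [|a _].
  by rewrite big_split /= -mulr_suml p1 mul1r -(natr1 n) mulrDl mul1r addrC.
rewrite -mulrDr -IH; congr (_ * _).
rewrite (@eq_iid_mean _ _ _ _ _ (fun s => X a ^+ 2 + (2 * X a * (\sum_i X (s i))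
   + (\sum_i X (s i)) ^+ 2))) => [|s].
  by rewrite !iid_meanD iid_mean_cst // iid_meanZ mean0 mulr0 add0r.
rewrite big_ord_recl fcons0 (eq_bigr (fun i => X (s i))) => [|i _]; first by ring.
by rewrite fcons_lift.
Qed.

Lemma bernoulli_deviation (R : realType) (k x : R) (M : nat) :
  (0 < M)%N -> 0 <= k <= 1 -> 0 < x ->
  iid_prob (fun b : bool => if b then k else 1 - k)
    (fun s : {ffun 'I_M -> bool} => x < `|M%:R^-1 * \sum_m (s m)%:R - k|) <=
  k * (1 - k) / (M%:R * x ^+ 2).
Proof.
move=> M0 /andP[k0 k1] x0; set p := fun _ => _.
have p0 b : 0 <= p b by case: b; rewrite /= ?subr_ge0.
have p1 : \sum_b p b = 1 by rewrite big_bool /=; ring.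
have MR : 0 < M%:R :> R by rewrite ltr0n.
have M_neq0 : M%:R != 0 :> R by rewrite gt_eqF.
pose X (b : bool) : R := b%:R - k.
have pX : \sum_b p b * X b = 0 by rewrite big_bool /= /X mulr1n mulr0n; ring.
have vE : \sum_b p b * X b ^+ 2 = k * (1 - k).
  by rewrite big_bool /= /X mulr1n mulr0n; ring.
rewrite ler_pdivlMr ?mulr_gt0 ?exprn_gt0 //.
rewrite -vE -[leRHS](mulKf M_neq0) -(iid_variance M p1 pX) -iid_meanZ.
rewrite mulrC -iid_meanZ; apply: le_iid_mean => // s.
have sE : \sum_i X (s i) = M%:R * (M%:R^-1 * \sum_m (s m)%:R - k).
  by rewrite sumrB sumr_const card_ord mulrBr mulVKf // mulr_natl.
case: (boolP (x < _)) => [xlt|_]; last first.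
  by rewrite mulr0n mulr0 mulr_ge0 ?sqr_ge0 // invr_ge0 ltW.
rewrite mulr1n mulr1 sE exprMn (expr2 M%:R) -!mulrA mulKf // ler_wpM2l ?(ltW MR) //.
by rewrite -[leRHS]real_normK ?num_real // lerXn2r ?nnegrE ?(ltW x0) ?(ltW xlt).
Qed.

(** * Bounds on outer probabilities *)

Section negligible_up_to.
Local Open Scope ereal_scope.
Context d (Omega : measurableType d) (R : realType) (P : probability Omega R).

(** A bound on the outer measure of [Q], through a measurable cover, because [Q] may be a union over
    uncountably many parameters. *)
Definition negligible_up_to (x : \bar R) (Q : set Omega) : Prop :=
  exists B, [/\ measurable B, P B <= x & Q `<=` B].

Lemma negligible_up_toS x y (Q Q' : set Omega) : x <= y -> Q' `<=` Q ->
  negligible_up_to x Q -> negligible_up_to y Q'.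
Proof.
move=> xy QQ' [B [mB PB QB]]; exists B; split=> //; first exact: le_trans xy.
exact: subset_trans QB.
Qed.

Lemma negligible_up_toU x y (Q Q' : set Omega) :
  negligible_up_to x Q -> negligible_up_to y Q' -> negligible_up_to (x + y) (Q `|` Q').
Proof.
move=> [B [mB PB QB]] [B' [mB' PB' QB']]; exists (B `|` B'); split.
- exact: measurableU.
- by apply: le_trans (measureU2 _ _ _) _ => //; rewrite leeD.
- exact: setUSS.
Qed.

Lemma negligible_up_to_exists (I : finType) (x : I -> \bar R) (Q : I -> set Omega) :
  (forall i, negligible_up_to (x i) (Q i)) ->
  negligible_up_to (\sum_i x i) [set w | exists i, Q i w].
Proof.
move=> xQ.
suff H (r : seq I) : negligible_up_to (\sum_(i <- r) x i) [set w | exists2 i, i \in r & Q i w].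
  by apply: negligible_up_toS (lexx _) _ (H _) => w /= [i Qi]; exists i; rewrite ?mem_index_enum.
elim: r => [|i r IH].
  by exists set0; split=> //; [rewrite measure0 big_nil|move=> w [i]].
rewrite big_cons; apply: negligible_up_toS (lexx _) _ (negligible_up_toU (xQ i) IH) => w /= [j].
by rewrite inE => /orP[/eqP ->|jr] Qj; [left|right; exists j].
Qed.

Lemma with_probabilityC (x : R) (Q Q' : set Omega) :
  negligible_up_to x%:E Q' -> (forall w, ~ Q' w -> Q w) -> with_probability P (1 - x)%R Q.
Proof.
move=> [B [mB PB QB]] Q'Q; exists (~` B); split=> [||w Bw].
- exact: measurableC.
- rewrite probability_setC // EFinB leeB //.
- by apply: Q'Q => /QB.
Qed.

End negligible_up_to.

(** * Augmented samples *)

Section augmentation.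
Context d (T : measurableType d) (R : realType).
Variables (A : R.-pker T ~> T) (D : probability T R).

Definition kmass (C : set T) (z : T) : R := fine (A z C).

Lemma kmassE C z : measurable C -> (kmass C z)%:E = A z C.
Proof. by move=> mC; rewrite fineK // mass_fin_num // prob_kernel. Qed.

Lemma kmass01 C z : measurable C -> 0 <= kmass C z <= 1.
Proof. by move=> mC; apply: mass01 => //; exact: prob_kernel. Qed.

Lemma measurable_kmass C : measurable C -> measurable_fun setT (kmass C).
Proof.
move=> mC; apply: (measurableT_comp (f := fine))  => //.
exact: measurable_kernel.
Qed.

Context d' (Omega : measurableType d') (P : probability Omega R) (N M : nat).
Variables (Z : 'I_N -> Omega -> T) (Zt : 'I_N -> 'I_M -> Omega -> T).
Hypotheses (mZ : forall n, measurable_fun setT (Z n))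
  (mZt : forall n m, measurable_fun setT (Zt n m)).
Hypothesis law : forall (B : 'I_N -> set T) (C : 'I_N -> 'I_M -> set T),
  (forall n, measurable (B n)) -> (forall n m, measurable (C n m)) ->
  P [set w | forall n, B n (Z n w) /\ forall m, C n m (Zt n m w)] =
  \big[mule/1%E]_(n < N) (\int[D]_(z in B n) \big[mule/1%E]_(m < M) A z (C n m))%E.

Let integral_one B : measurable B ->
  (\int[D]_(z in B) \big[mule/1%E]_(m < M) A z setT = D B)%E.
Proof.
move=> mB; rewrite -[RHS]mul1e -(integral_cst D mB); apply: eq_integral => z _.
by rewrite big1 // => m _; exact: prob_kernel.
Qed.

(** Taking the full space wherever no constraint is wanted makes the corresponding factor of the
    product formula 1; the two marginal laws that follow are obtained in the same way. *)
Lemma sample_law (B : 'I_N -> set T) : (forall n, measurable (B n)) ->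
  P [set w | forall n, B n (Z n w)] = \big[mule/1%E]_(n < N) D (B n).
Proof.
move=> mB; rewrite (_ : mkset _ = [set w | forall n, B n (Z n w) /\
    forall m : 'I_M, [set: T] (Zt n m w)]); last first.
  by apply/seteqP; split=> w Bw n; [split; [exact: Bw|]|case: (Bw n)].
by rewrite (law (C := fun _ _ => setT)) //; apply: eq_bigr => n _; exact: integral_one.
Qed.

Lemma point_law n B : measurable B -> P [set w | B (Z n w)] = D B.
Proof.
move=> mB; pose B' i := if i == n then B else setT.
have := sample_law (B := B'); rewrite (bigD1 n) //= big1 => [|i /negbTE ni]; last first.
  by rewrite /B' ni probability_setT.
rewrite mule1 /B' eqxx => <-; last by move=> i; case: ifP.
congr (P _); apply/seteqP; split=> w /=; first by move=> Bw i; case: eqP => [->|].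
by move=> /(_ n); rewrite eqxx.
Qed.

Lemma augmentation_law n (B : set T) (C : 'I_M -> set T) :
  measurable B -> (forall m, measurable (C m)) ->
  P [set w | B (Z n w) /\ forall m, C m (Zt n m w)] =
  (\int[D]_(z in B) \big[mule/1%E]_(m < M) A z (C m))%E.
Proof.
move=> mB mC; pose B' i := if i == n then B else setT.
pose C' i m := if i == n then C m else setT.
have := law (B := B') (C := C'); rewrite (bigD1 n) //= big1 => [|i /negbTE ni]; last first.
  by rewrite /B' /C' ni integral_one // probability_setT.
rewrite mule1 /B' /C' eqxx => <-; last 2 first.
- by move=> i; case: ifP.
- by move=> i m; case: ifP.
congr (P _); apply/seteqP; split=> w /=.
  by move=> [Bw Cw] i; case: eqP => [->|].
by move=> /(_ n); rewrite eqxx.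
Qed.

(** This transfers finite computations to [Omega]: the quantized points are iid on [S], and the
    event is a finite union over the patterns [s] satisfying [Q]. *)
Lemma sample_negligible (S : finType) (q : T -> S) (Q : pred {ffun 'I_N -> S}) :
  (forall s, measurable (q @^-1` [set s])) ->
  negligible_up_to P (iid_prob (fun s => fine (D (q @^-1` [set s]))) Q)%:E
    [set w | Q [ffun n => q (Z n w)]].
Proof.
move=> mq; rewrite /iid_prob /iid_mean -sumEFin.
apply: (@negligible_up_toS _ _ _ _ _ _ [set w | exists s, Q s /\
    forall n, (q @^-1` [set s n]) (Z n w)] _ (lexx _)).
  by move=> w Qw; exists [ffun n => q (Z n w)]; split=> // n /=; rewrite ffunE.
apply: negligible_up_to_exists => s; case: (boolP (Q s)) => Qs; last first.
  exists set0; split=> //; last by move=> w [].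
  by rewrite measure0 mulr0n mulr0.
exists [set w | forall n, (q @^-1` [set s n]) (Z n w)]; split; last by move=> w [].
  rewrite (_ : mkset _ = \bigcap_(n in [set: 'I_N]) (Z n @^-1` (q @^-1` [set s n]))).
    apply: fin_bigcap_measurable => // n _.
    by rewrite -[X in measurable X]setTI; exact: mZ.
  by apply/seteqP; split=> w /= sw n; [move=> _|]; exact: sw.
rewrite (sample_law (B := fun n => q @^-1` [set s n])) // mulr1n mulr1 -prodEFin.
rewrite le_eqVlt; apply/orP; left; apply/eqP.
by apply: eq_bigr => n _; rewrite fineK //; exact: (mass_fin_num (probability_setT D)).
Qed.

(* On a set of points [z] where [A z C] is nearly constant, the indicators of
   [Zt n m w \in C] are conditionally iid Bernoulli variables. *)
Lemma augmentation_deviation n (C : set T) (v a : R) :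
  measurable C -> (0 < M)%N -> 0 < a ->
  (forall z, kmass C z * (1 - kmass C z) <= v) ->
  negligible_up_to P (16 * v / (M%:R * a ^+ 2))%:E
    [set w | a < `|M%:R^-1 * \sum_(m < M) (Zt n m w \in C)%:R - kmass C (Z n w)|].
Proof.
move=> mC M0 a0 kv.
have a4 : 0 < 4 / a by rewrite divr_gt0.
have [S [q [mq qk]]] := @quantization _ T R unit (fun=> kmass C) (Num.truncn (4 / a)).+1
  isT (fun=> measurable_kmass mC) (fun _ z => kmass01 z mC).
have {}qk z z' : q z = q z' -> `|kmass C z - kmass C z'| <= a / 4.
  move=> /qk/(_ tt)/le_trans; apply; rewrite -[a / 4]invf_div.
  by rewrite lef_pV2 ?posrE // ltW // truncnS_gt.
set c := 16 * v / _.
have c0 : 0 <= c.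
  have v0 : 0 <= v.
    have /andP[k0 k1] := kmass01 point mC.
    by apply: le_trans (kv point); rewrite mulr_ge0 // subr_ge0.
  by rewrite /c divr_ge0 ?mulr_ge0 ?exprn_ge0 ?ler0n // ltW.
(* The budget [c] is shared among the fibres of [q] in proportion to their masses under [D]. *)
have -> : c%:E = (\sum_s c%:E * D (q @^-1` [set s]))%E.
  rewrite -[LHS]mule1 -[X in (_ * X%:E)%E](sum_fibre_mass (probability_setT D) mq).
  rewrite -sumEFin ge0_sume_distrr => [|s _]; last by rewrite lee_fin fine_ge0.
  by apply: eq_bigr => s _; rewrite fineK //; exact: (mass_fin_num (probability_setT D)).
apply: (@negligible_up_toS _ _ _ _ _ _ [set w | exists s, q (Z n w) = s /\
    a < `|M%:R^-1 * \sum_(m < M) (Zt n m w \in C)%:R - kmass C (Z n w)|] _ (lexx _)).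
  by move=> w /= aw; exists (q (Z n w)).
apply: negligible_up_to_exists => s.
set B := q @^-1` [set s]; have mB : measurable B := mq s.
pose k0 := fibre_value q (kmass C) s.
have kk0 z : B z -> `|kmass C z - k0| <= a / 4.
  by move=> /= qz; rewrite /k0 -qz; have [z' /esym/qk + ->] := fibre_valueP q (kmass C) z.
pose avg (b : {ffun 'I_M -> bool}) : R := M%:R^-1 * \sum_m (b m)%:R.
pose p z (b : bool) : R := if b then kmass C z else 1 - kmass C z.
(* With a centre [k0] fixed on the fibre, [bad] depends on the pattern [b] alone. As [k0] is within
   [a / 4] of [kmass C z], a deviation above [a] forces [bad], and [bad] forces one above [a / 4],
   hence the factor 16 from Chebyshev's inequality. *)
pose bad b := a / 2 < `|avg b - k0|.
pose G (b : {ffun 'I_M -> bool}) z : \bar R := (\prod_m p z (b m) * (bad b)%:R)%:E.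
have p0 z b : 0 <= p z b.
  by have /andP[? ?] := kmass01 z mC; case: b; rewrite /p ?subr_ge0.
have G0 b z : (0 <= G b z)%E by rewrite lee_fin mulr_ge0 ?ler0n // prodr_ge0.
have mG b : measurable_fun B (G b).
  apply: measurable_funTS; apply/measurable_EFinP; apply: measurable_funM => //.
  apply: measurable_prod => m _; rewrite /p; case: (b m); first exact: measurable_kmass.
  by apply: measurable_funB => //; exact: measurable_kmass.
apply: (@negligible_up_toS _ _ _ _ (\sum_b \int[D]_(z in B) G b z)%E _
    [set w | exists b : {ffun 'I_M -> bool}, bad b /\ B (Z n w) /\
      forall m, (if b m then C else ~` C) (Zt n m w)]).
- rewrite -ge0_integral_sum // -(integral_cst D mB c%:E).
  apply: ge0_le_integral => //.
  + by move=> z _; exact: sume_ge0.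
  + exact: emeasurable_sum.
  + move=> z Bz /=; rewrite /G sumEFin lee_fin.
    rewrite -/(iid_mean (p z) (fun b => (bad b)%:R)).
    have a40 : 0 < a / 4 by rewrite divr_gt0.
    apply: le_trans (_ : iid_prob (p z)
        (fun b : {ffun 'I_M -> bool} => a / 4 < `|avg b - kmass C z|) <= _).
      apply: le_iid_mean => // b; rewrite ler_nat.
      case: (boolP (bad b)) => // bb; rewrite (_ : _ < _) //.
      move: bb (kk0 z Bz); rewrite /bad => bb kz.
      have := ler_distD (kmass C z) (avg b) k0; lra.
    apply: le_trans (bernoulli_deviation M0 (kmass01 z mC) a40) _.
    have -> : c = v / (M%:R * (a / 4) ^+ 2).
      by rewrite /c; field; rewrite !gt_eqF // ltr0n.
    by rewrite ler_wpM2r // invr_ge0 mulr_ge0 ?exprn_ge0 ?ler0n // ltW.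
- move=> w [qw aw]; exists [ffun m => Zt n m w \in C]; split; last first.
    split=> // m; rewrite ffunE; case: ifPn => [/set_mem //|].
    by move=> /negP CZ /mem_set.
  rewrite /bad /avg; under eq_bigr do rewrite ffunE.
  have := kk0 _ qw.
  have := ler_distD k0 (M%:R^-1 * \sum_(m < M) (Zt n m w \in C)%:R) (kmass C (Z n w)).
  rewrite (distrC k0); lra.
apply: negligible_up_to_exists => b; case: (boolP (bad b)) => bb; last first.
  by exists set0; split=> //; [rewrite measure0 integral_ge0|move=> w []].
have mCb m : measurable (if b m then C else ~` C).
  by case: (b m) => //; exact: measurableC.
exists [set w | B (Z n w) /\ forall m, (if b m then C else ~` C) (Zt n m w)].
split; last by move=> w [].
  rewrite (_ : mkset _ = Z n @^-1` B `&` \bigcap_(m in [set: 'I_M])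
     (Zt n m @^-1` (if b m then C else ~` C))).
    apply: measurableI; first by rewrite -[X in measurable X]setTI; exact: mZ.
    apply: fin_bigcap_measurable => // m _.
    by rewrite -[X in measurable X]setTI; exact: mZt.
  apply/seteqP; split=> w /= [Bw Cw]; split=> // m; [move=> _|]; exact: Cw.
rewrite (@augmentation_law n B (fun m => if b m then C else ~` C)) //.
rewrite le_eqVlt; apply/orP; left; apply/eqP.
apply: eq_integral => z _; rewrite /G bb mulr1n mulr1 -prodEFin.
apply: eq_bigr => m _; rewrite /p; case: (b m); first by rewrite kmassE.
have Az1 : A z setT = 1%E := prob_kernel z.
have Az_fin : (A z setT < +oo)%E by rewrite Az1 ltry.
rewrite EFinB kmassE // -setTD measureD // ?setTI; try exact: Az_fin.
by congr (_ - _)%E; exact: Az1.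
Qed.

End augmentation.

Lemma vanishing_mass d (T : measurableType d) (R : realType)
    (mu : {measure set T -> \bar R}) (F : (set T)^nat) (x : R) :
  mu setT = 1%E -> 0 < x -> (forall k, measurable (F k)) ->
  (forall k l, (k <= l)%N -> F l `<=` F k) -> (forall z, exists k, ~ F k z) ->
  exists k, (mu (F k) < x%:E)%E.
Proof.
move=> mu1 x0 mF dF F0.
have F0E : \bigcap_k F k = set0.
  by rewrite -subset0 => z Fz; have [k] := F0 z; apply; exact: Fz.
have : mu \o F @ \oo --> mu (\bigcap_k F k).
  apply: nonincreasing_cvg_mu => //.
  - by rewrite -ge0_fin_numE // mass_fin_num.
  - by rewrite F0E.
  - by move=> k l kl; apply/subsetPset; exact: dF.
rewrite F0E measure0 => /(_ [set y | (y < x%:E)%E]).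
have : nbhs (0%E : \bar R) [set y | (y < x%:E)%E].
  by apply: open_nbhs_nbhs; split; [exact: open_ereal_lt_ereal|rewrite /= lte_fin].
by move=> nx /(_ nx) [k _ Fk]; exists k; exact: (Fk k (leqnn k)).
Qed.

(** * Uniform approximation of the augmented loss by the masses of finitely many cells *)

Section augmented_loss.
Context d (T : measurableType d) (R : realType) (Theta : Type).
Variables (A : R.-pker T ~> T) (D : probability T R) (g : T -> Theta -> R).
Hypotheses (g01 : forall z t, 0 <= g z t <= 1)
  (mg : forall t, measurable_fun setT (g ^~ t)).

(** The augmented loss of an abstract family [g], convertible with [loss_aug] when [g] is the
    loss. *)
Definition smoothed (z : T) (t : Theta) : R := \int[A z]_z' g z' t.

Lemma smoothed01 z t : 0 <= smoothed z t <= 1.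
Proof. by apply: Rintegral01 => //; exact: prob_kernel. Qed.

Lemma measurable_smoothed t : measurable_fun setT (smoothed ^~ t).
Proof.
apply: (measurableT_comp (f := fine)) => //.
apply: (@measurable_fun_integral_kernel _ _ _ _ _ A _ (fun z => (g z t)%:E)) => [U mU|z|].
- exact: measurable_kernel.
- by rewrite lee_fin; case/andP: (g01 z t).
- by apply/measurable_EFinP.
Qed.

(** * Comparisons through a finite partition with a leftover cell [s0] *)

Section partition.
Variables (S : finType) (s0 : S) (e : T -> S) (x : R).
Hypotheses (me : forall s, measurable (e @^-1` [set s])) (x0 : 0 <= x).
Hypothesis osc : forall t z z', e z = e z' -> e z != s0 -> `|g z t - g z' t| <= x.

Let y t s := fibre_value e (g ^~ t) s.

Let gy z t : `|g z t - y t (e z)| <= x + (e z == s0)%:R.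
Proof.
rewrite /y; have [z' z'z ->] := fibre_valueP e (g ^~ t) z.
case: eqP => [_|/eqP zs0]; last by rewrite addr0 osc.
rewrite mulr1n ler_norml.
by have := g01 z t; have := g01 z' t; move: x0; lra.
Qed.

Let smoothed_approx z t :
  `|smoothed z t - \sum_s y t s * kmass A (e @^-1` [set s]) z| <=
    x + kmass A (e @^-1` [set s0]) z.
Proof.
have [my <-] := Rintegral_finite_range (prob_kernel (s := A) z) (y t) me.
have y01 s : 0 <= y t s <= 1 by exact: g01.
apply: dist_Rintegral_le => //; first exact: prob_kernel.
move=> z' /= ez'; apply: le_trans (gy z' t) _.
by case: eqP => // _; rewrite addr0.
Qed.

Let empirical_approx M (xs : 'I_M -> T) t : (0 < M)%N ->
  `|M%:R^-1 * \sum_m g (xs m) t -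
     \sum_s y t s * (M%:R^-1 * \sum_m (xs m \in e @^-1` [set s])%:R)| <=
   x + M%:R^-1 * \sum_m (xs m \in e @^-1` [set s0])%:R.
Proof.
move=> M0; have MR : M%:R != 0 :> R by rewrite pnatr_eq0 -lt0n.
have inE' z s : (z \in e @^-1` [set s]) = (e z == s).
  by apply/idP/eqP => [/set_mem|] //= ez; exact/mem_set.
have -> : \sum_s y t s * (M%:R^-1 * \sum_m (xs m \in e @^-1` [set s])%:R) =
    M%:R^-1 * \sum_m y t (e (xs m)).
  under eq_bigr do rewrite mulrCA mulr_sumr.
  rewrite -mulr_sumr exchange_big /=; congr (_ * _); apply: eq_bigr => m _.
  rewrite (bigD1 (e (xs m))) //= inE' eqxx mulr1 big1 ?addr0 // => s sm.
  by rewrite inE' eq_sym (negbTE sm) mulr0.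
have -> : x = M%:R^-1 * \sum_(m < M) x.
  by rewrite sumr_const card_ord -[x *+ M]mulr_natl mulKf.
rewrite -mulrBr -mulrDr -sumrB -big_split normrM ger0_norm ?invr_ge0 //.
rewrite ler_wpM2l ?invr_ge0 //; apply: le_trans (ler_norm_sum _ _ _) _.
by apply: ler_sum => m _; rewrite inE'; exact: gy.
Qed.

(** Here [u] and [v] are two families of cell masses. The leftover mass [u s0] is traded for [v s0]
    at the cost of a second copy of the sum, so that only the [v] side has to be known to have a
    small leftover cell. *)
Let compare (u v : S -> R) (t : Theta) a b : (forall s, 0 <= y t s <= 1) ->
  `|a - \sum_s y t s * u s| <= x + u s0 -> `|b - \sum_s y t s * v s| <= x + v s0 ->
  `|a - b| <= 2 * x + 2 * v s0 + 2 * \sum_s `|u s - v s|.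
Proof.
move=> y01 au bv; have us0 : u s0 - v s0 <= \sum_s `|u s - v s|.
  rewrite (bigD1 s0) //= (le_trans (ler_norm _)) // lerDl.
  by apply: sumr_ge0.
have : `|\sum_s y t s * u s - \sum_s y t s * v s| <= \sum_s `|u s - v s|.
  rewrite -sumrB; apply: le_trans (ler_norm_sum _ _ _) _; apply: ler_sum => s _.
  have /andP[ys0 ys1] := y01 s.
  by rewrite -mulrBr normrM ger0_norm // ler_piMl.
rewrite !ler_norml in au bv * => uv; lra.
Qed.

Lemma smoothed_dist z z' t :
  `|smoothed z t - smoothed z' t| <= 2 * x + 2 * kmass A (e @^-1` [set s0]) z' +
    2 * \sum_s `|kmass A (e @^-1` [set s]) z - kmass A (e @^-1` [set s]) z'|.
Proof.
apply: (@compare (fun s => kmass A (e @^-1` [set s]) z)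
  (fun s => kmass A (e @^-1` [set s]) z') t); try exact: smoothed_approx.
by move=> s; exact: g01.
Qed.

Lemma empirical_dist M (xs : 'I_M -> T) z t : (0 < M)%N ->
  `|M%:R^-1 * \sum_m g (xs m) t - smoothed z t| <=
    2 * x + 2 * kmass A (e @^-1` [set s0]) z +
    2 * \sum_s `|M%:R^-1 * \sum_m (xs m \in e @^-1` [set s])%:R -
                 kmass A (e @^-1` [set s]) z|.
Proof.
move=> M0; apply: (@compare (fun s => M%:R^-1 * \sum_m (xs m \in e @^-1` [set s])%:R)
  (fun s => kmass A (e @^-1` [set s]) z) t); last exact: smoothed_approx.
  by move=> s; exact: g01.
exact: empirical_approx.
Qed.

End partition.

Hypothesis cells : forall x : R, 0 < x -> exists r : T -> nat,
  (forall i, measurable (r @^-1` [set i])) /\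
  forall t z z', r z = r z' -> `|g z t - g z' t| <= x.

(** All cells of index at least [k] are merged into the leftover cell. For each [z] its mass under
    [A z] tends to 0 as [k] grows, hence so does the mass under [D] of the [z] for which it exceeds
    [x]: [vanishing_mass] is used twice. *)
Lemma finite_partition (x : R) : 0 < x -> exists (S : finType) (s0 : S) (e : T -> S),
  [/\ forall s, measurable (e @^-1` [set s]),
      forall t z z', e z = e z' -> e z != s0 -> `|g z t - g z' t| <= x &
      (D [set z | (x < kmass A (e @^-1` [set s0]) z)%R] < x%:E)%E].
Proof.
move=> x0; have [r [mr rosc]] := cells x0.
pose rest k := [set z | (k <= r z)%N].
have mrest k : measurable (rest k).
  rewrite (_ : rest k = ~` \bigcup_(i in `I_k) (r @^-1` [set i])).
    by apply: measurableC; exact: bigcup_measurable.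
  apply/seteqP; split=> [z kz [i /= ik ri]|z nz /=].
    by move: kz; rewrite /rest /= ri leqNgt ik.
  by rewrite /rest /= leqNgt; apply/negP => rk; apply: nz; exists (r z).
have restS k l : (k <= l)%N -> rest l `<=` rest k.
  by move=> kl z; exact: leq_trans.
have rest0 z : exists k, ~ rest k z by exists (r z).+1; rewrite /rest /= ltnn.
have [|||k Dk] := @vanishing_mass _ _ _ D (fun k => [set z | x < kmass A (rest k) z]) x
    (probability_setT D) x0.
- move=> k; rewrite (_ : mkset _ = kmass A (rest k) @^-1` `]x, +oo[%classic).
    by rewrite -[X in measurable X]setTI; apply: measurable_kmass.
  by apply/seteqP; split=> z /=; rewrite in_itv /= andbT.
- move=> k l kl z /= /lt_le_trans; apply.
  rewrite -lee_fin !kmassE //; apply: le_measure; rewrite ?inE //.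
  exact: restS.
- move=> z; have [k Azk] := vanishing_mass (prob_kernel (s := A) z) x0 mrest restS rest0.
  by exists k; apply/negP; rewrite -leNgt -lee_fin kmassE // ltW.
pose e z : 'I_k.+1 := inord (minn (r z) k).
have eE z : e z = minn (r z) k :> nat by rewrite inordK // ltnS geq_minr.
have eS0 : e @^-1` [set ord_max] = rest k.
  apply/seteqP; split=> [z /(congr1 val)|z kz].
    by rewrite /= eE => /minn_idPr.
  by apply: val_inj; rewrite /= eE; exact/minn_idPr.
exists 'I_k.+1, ord_max, e; split; last by rewrite eS0.
- move=> s; have [->|sk] := eqVneq s ord_max; first by rewrite eS0.
  have {}sk : (s < k)%N.
    by rewrite ltn_neqAle -ltnS ltn_ord andbT; apply: contraNneq sk => sk; exact/eqP/val_inj.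
  rewrite (_ : _ @^-1` _ = r @^-1` [set val s]) //.
  apply/seteqP; split=> z /= => [/(congr1 val)/=|rs].
    rewrite eE => rs; move: sk; rewrite -rs gtn_min ltnn orbF => /ltnW/minn_idPl.
    by rewrite rs.
  by apply: val_inj; rewrite /= eE rs; exact/minn_idPl/ltnW.
- move=> t z z' zz' zmax; apply: rosc.
  have rk u : e u != ord_max -> (r u < k)%N.
    move=> umax; rewrite ltnNge; apply: contra umax => ku.
    by apply/eqP/val_inj; rewrite /= eE; exact/minn_idPr.
  have := congr1 val zz'; rewrite /= !eE.
  have zk := rk z zmax; have z'k : (r z' < k)%N by apply: rk; rewrite -zz'.
  by rewrite (minn_idPl (ltnW zk)) (minn_idPl (ltnW z'k)).
Qed.

End augmented_loss.

(** * The deviation inequality for the augmented sample *)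

Section uniform_bound.
Context d (T : measurableType d) (R : realType) (Theta : Type).
Variables (A : R.-pker T ~> T) (D : probability T R) (g : T -> Theta -> R).
Hypotheses (g01 : forall z t, 0 <= g z t <= 1)
  (mg : forall t, measurable_fun setT (g ^~ t)).
Hypothesis cells : forall x : R, 0 < x -> exists r : T -> nat,
  (forall i, measurable (r @^-1` [set i])) /\
  forall t z z', r z = r z' -> `|g z t - g z' t| <= x.

(** Outside three events, of probabilities at most [delta / 2], [delta / 4] and [delta / 4], the
    quantized sample has a small excess, the cell frequencies of the augmentations are accurate, and
    no [Z n] lies in the bad set [Bd]; what remains is deterministic and uniform in [t]. *)
Lemma augmented_uniform_bound (N : nat) (delta eta : R) (t0 : Theta) :
  (0 < N)%N -> 0 < delta < 1 -> 0 < eta ->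
  exists M0 : nat,
    ((forall C z, measurable C -> kmass A C z * (1 - kmass A C z) = 0) -> M0 = 1%N) /\
    forall M : nat, (0 < M)%N -> (M0 <= M)%N ->
    forall d' (Omega : measurableType d') (P : probability Omega R)
      (Z : 'I_N -> Omega -> T) (Zt : 'I_N -> 'I_M -> Omega -> T),
    (forall n, measurable_fun setT (Z n)) -> (forall n m, measurable_fun setT (Zt n m)) ->
    (forall (B : 'I_N -> set T) (C : 'I_N -> 'I_M -> set T),
      (forall n, measurable (B n)) -> (forall n m, measurable (C n m)) ->
      P [set w | forall n, B n (Z n w) /\ forall m, C n m (Zt n m w)] =
      \big[mule/1%E]_(n < N) (\int[D]_(z in B n) \big[mule/1%E]_(m < M) A z (C n m))%E) ->
    negligible_up_to P delta%:E [set w | exists t,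
      (N * M)%:R^-1 * \sum_(n < N) \sum_(m < M) g (Zt n m w) t <=
      (N * M)%:R^-1 * \sum_(n < N) \sum_(m < M) g (Zt n m w) t0 /\
      2 * rademacher (smoothed A g) (fun n => Z n w) +
      4 * Num.sqrt (2 * ln (delta / 2)^-1 / N%:R) + eta <
      (\int[D]_z smoothed A g z t) - \int[D]_z smoothed A g z t0].
Proof.
move=> N0 /andP[delta0 delta1] eta0; pose mu t : R := \int[D]_z smoothed A g z t.
have NR : 0 < N%:R :> R by rewrite ltr0n.
(* The factor 50 counts the errors below: 14 for [mu] at [t] and [t0], then 12 each for twice the
   Rademacher complexity, the sample means and the augmented means. The last bound makes the union
   over the [N] points cost at most [delta / 4]. *)
have [x [x0 xeta xdelta]] : exists x : R, [/\ 0 < x, 50 * x <= eta & x <= delta / (4 * N%:R)].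
  have d4N : 0 < delta / (4 * N%:R) by rewrite divr_gt0 // mulr_gt0.
  exists (Num.min (eta / 50) (delta / (4 * N%:R))); split.
  - by rewrite lt_min d4N andbT divr_gt0.
  - by rewrite mulrC -ler_pdivlMr // ge_min lexx.
  - by rewrite ge_min lexx orbT.
have [S [s0 [e [me eosc Dbad]]]] := finite_partition A D cells x0.
pose k s := kmass A (e @^-1` [set s]).
have KR : 0 < #|S|%:R :> R by rewrite ltr0n; apply/card_gt0P; exists s0.
have Kx : 0 < #|S|%:R / x by rewrite divr_gt0.
(* Deviations of at most [a] in every cell add up to at most [x]. *)
pose a := x / #|S|%:R.
have a0 : 0 < a by rewrite divr_gt0.
have sum_a : \sum_(s : S) a = x by rewrite sumr_const -[LHS]mulr_natl mulrC mulfVK // gt_eqF.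
have [S' [q [mq qk]]] := @quantization _ T R S k (Num.truncn (#|S|%:R / x)).+1
  isT (fun s => measurable_kmass A (me s)) (fun s z => kmass01 A z (me s)).
have {}qk z z' s : q z = q z' -> `|k s z - k s z'| <= a.
  move=> /qk/(_ s)/le_trans; apply; rewrite /a -[x / _]invf_div.
  by rewrite lef_pV2 ?posrE // ltW // truncnS_gt.
pose Bd := [set z | x < k s0 z].
have mBd : measurable Bd.
  rewrite (_ : Bd = k s0 @^-1` `]x, +oo[%classic).
    by rewrite -[X in measurable X]setTI; apply: measurable_kmass.
  by apply/seteqP; split=> z; rewrite /Bd /= in_itv /= andbT.
(* [hhat] factors the augmented loss through the finite code [q]. Off [Bd] the three terms of
   [smoothed_dist] are at most [2 * x] each, whence [6 * x]; integrating adds the mass of [Bd],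
   whence [7 * x]. *)
pose hhat s t := fibre_value q (smoothed A g ^~ t) s.
have hhat01 s t : 0 <= hhat s t <= 1 by exact: smoothed01.
have hhatE z t : ~ Bd z -> `|smoothed A g z t - hhat (q z) t| <= 6 * x.
  move=> Bz; rewrite /hhat; have [z' z'z ->] := fibre_valueP q (smoothed A g ^~ t) z.
  rewrite distrC.
  apply: le_trans (smoothed_dist A g01 mg me (ltW x0) eosc z' z t) _.
  have kz : k s0 z <= x by rewrite leNgt; exact/negP.
  have : \sum_s `|k s z' - k s z| <= x by rewrite -sum_a; apply: ler_sum => s _; exact: qk.
  by rewrite -/(k s0 z); lra.
pose p s := fine (D (q @^-1` [set s])).
have p_ge0 s : 0 <= p s by rewrite fine_ge0.
have p_sum1 : \sum_s p s = 1 by exact: (sum_fibre_mass (probability_setT D)).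
have muE t : `|mu t - \sum_s p s * hhat s t| <= 7 * x.
  have [mh hE] := Rintegral_finite_range (probability_setT D) (hhat ^~ t) mq.
  rewrite (eq_bigr (fun s => hhat s t * p s)) => [|s _]; last by rewrite mulrC.
  rewrite -hE (_ : 7 * x = 6 * x + x); last by ring.
  apply: le_trans (_ : 6 * x + fine (D Bd) <= _).
    apply: dist_Rintegral_le => //.
    - exact: probability_setT.
    - exact: measurable_smoothed.
    - by move=> z; exact: smoothed01.
    - by rewrite mulr_ge0 // ltW.
    - by move=> z; exact: hhatE.
  by rewrite lerD2l -lee_fin fineK ?ltW // (mass_fin_num (probability_setT D)).
pose det := forall C z, measurable C -> kmass A C z * (1 - kmass A C z) = 0.
(* [v] bounds the variances [k * (1 - k)]. When all of them vanish one augmentation per point is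
   enough; otherwise [M0] makes the union bound over [N * #|S|] frequencies at most [delta / 4]. *)
pose v : R := if pselect det then 0 else 1.
pose M0 := if pselect det then 1%N
  else (Num.truncn (64 * N%:R * #|S|%:R / (a ^+ 2 * delta))).+1.
have kv C z : measurable C -> kmass A C z * (1 - kmass A C z) <= v.
  move=> mC; rewrite /v; case: (pselect det) => [dt|ndt] /=; first by rewrite dt.
  by have /andP[? ?] := kmass01 A z mC; rewrite /= mulr_ile1 ?subr_ge0 // lerBlDr lerDl.
exists M0; split=> [dt|M M_gt0 leM d' Omega P Z Zt mZ mZt law].
  by rewrite /M0; case: (pselect det).
have MR : 0 < M%:R :> R by rewrite ltr0n.
have vM : N%:R * #|S|%:R * (16 * v / (M%:R * a ^+ 2)) <= delta / 4.
  have a20 : 0 < a ^+ 2 by rewrite exprn_gt0.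
  move: leM; rewrite /M0 /v; case: (pselect det) => [dt|ndt] /= leM.
    by rewrite mulr0 mul0r mulr0 divr_ge0 // ltW.
  rewrite mulr1 mulrA (ler_pdivrMr _ _ (mulr_gt0 MR a20)).
  have : 64 * N%:R * #|S|%:R / (a ^+ 2 * delta) <= M%:R.
    by apply: le_trans (ltW (truncnS_gt _)) _; rewrite ler_nat.
  rewrite (ler_pdivrMr _ _ (mulr_gt0 a20 delta0)) => le64.
  have -> : delta / 4 * (M%:R * a ^+ 2) = M%:R * (a ^+ 2 * delta) / 4 by ring.
  rewrite ler_pdivlMr //; apply: le_trans le64.
  by rewrite le_eqVlt; apply/orP; left; apply/eqP; ring.
set u := 4 * _.
pose Q1 : set Omega := [set w | u <= excess p hhat t0 [ffun n => q (Z n w)]].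
pose Q2 : set Omega := [set w | exists n, exists s, a <
  `|M%:R^-1 * \sum_(m < M) (Zt n m w \in e @^-1` [set s])%:R - k s (Z n w)|].
pose Q3 : set Omega := [set w | exists n, Bd (Z n w)].
have negl1 : negligible_up_to P (delta / 2)%:E Q1.
  apply: negligible_up_toS (sample_negligible mZ law
    (fun s => u <= excess p hhat t0 s) mq) => //.
  by rewrite lee_fin; apply: excess_tail => //; lra.
have negl2 : negligible_up_to P (delta / 4)%:E Q2.
  apply: (@negligible_up_toS _ _ _ _
      (\sum_(n < N) \sum_(s : S) (16 * v / (M%:R * a ^+ 2))%:E)%E _ Q2) => //.
    rewrite (eq_bigr (fun=> (\sum_(s : S) 16 * v / (M%:R * a ^+ 2))%:E)) => [|n _].
      rewrite sumEFin lee_fin; apply: le_trans vM.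
      by set c := 16 * v / _; rewrite !sumr_const card_ord -mulrA !mulr_natl.
    by rewrite sumEFin.
  apply: negligible_up_to_exists => n; apply: negligible_up_to_exists => s.
  by apply: (augmentation_deviation mZ mZt law) => // z; exact: kv.
have negl3 : negligible_up_to P (delta / 4)%:E Q3.
  apply: (@negligible_up_toS _ _ _ _ (\sum_(n < N) x%:E)%E _ Q3) => //.
    rewrite sumEFin lee_fin sumr_const card_ord -[x *+ N]mulr_natl mulrC -ler_pdivlMr //.
    by rewrite -mulrA -invfM.
  apply: negligible_up_to_exists => n; exists [set w | Bd (Z n w)]; split=> //.
    by rewrite -[X in measurable X]setTI; exact: mZ.
  by rewrite (point_law law) // ltW.
apply: negligible_up_toS (negligible_up_toU negl1 (negligible_up_toU negl2 negl3)).
  by rewrite -!EFinD lee_fin; lra.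
move=> w [t [aug_le]]; rewrite -/(mu t) -/(mu t0) => big_gap.
apply: contrapT => /not_orP[NQ1 /not_orP[NQ2 NQ3]].
have good n : ~ Bd (Z n w) by move=> Bn; apply: NQ3; exists n.
pose zh := [ffun n => q (Z n w)].
have zhE n t' : `|smoothed A g (Z n w) t' - hhat (zh n) t'| <= 6 * x.
  by rewrite ffunE; exact: hhatE.
have exc : excess p hhat t0 zh < u by rewrite ltNge; apply/negP.
have dev := worst_deviation_ub p_ge0 p_sum1 hhat01 N0 zh t.
have rad : rademacher hhat zh <= rademacher (smoothed A g) (fun n => Z n w) + 6 * x.
  apply: le_trans (rademacher_le (c := fun=> 6 * x) t0 N0 (smoothed01 A g01 mg) _) _.
    by move=> n t'; rewrite distrC; exact: zhE.
  by rewrite lerD2l; exact: mean_le.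
pose mean_h t' := N%:R^-1 * \sum_(n < N) smoothed A g (Z n w) t'.
pose aug t' := N%:R^-1 * \sum_(n < N) (M%:R^-1 * \sum_(m < M) g (Zt n m w) t').
have mean_hE t' : `|sample_mean hhat zh t' - mean_h t'| <= 6 * x.
  rewrite -mulrBr -sumrB; apply: (norm_mean_le N0) => n.
  by rewrite distrC; exact: zhE.
have augE t' : `|aug t' - mean_h t'| <= 6 * x.
  rewrite -mulrBr -sumrB; apply: (norm_mean_le N0) => n.
  apply: le_trans (empirical_dist A g01 mg me (ltW x0) eosc (fun m => Zt n m w) (Z n w) t' M_gt0) _.
  have kz : k s0 (Z n w) <= x by rewrite leNgt; apply/negP; exact: good.
  have : \sum_s `|M%:R^-1 * \sum_(m < M) (Zt n m w \in e @^-1` [set s])%:R - k s (Z n w)| <= x.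
    rewrite -sum_a; apply: ler_sum => s _; rewrite leNgt; apply/negP => as_.
    by apply: NQ2; exists n, s.
  by rewrite -/(k s0 (Z n w)); lra.
have augw t' : (N * M)%:R^-1 * \sum_(n < N) \sum_(m < M) g (Zt n m w) t' = aug t'.
  by rewrite /aug natrM invfM -mulrA mulr_sumr.
rewrite !augw in aug_le.
move: exc dev; rewrite /excess -/u.
have := muE t; have := muE t0; have := mean_hE t; have := mean_hE t0.
have := augE t; have := augE t0; rewrite !ler_norml.
move: big_gap rad aug_le xeta.
move: (mean_h t) (mean_h t0) (aug t) (aug t0) (mu t) (mu t0).
move: (sample_mean hhat zh t) (sample_mean hhat zh t0) (rademacher hhat zh).
move: (\sum_s p s * hhat s t) (\sum_s p s * hhat s t0) (worst_deviation p hhat zh).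
by move: (rademacher (smoothed A g) _) => *; lra.
Qed.

End uniform_bound.

(** * Labelled graphs *)

(** [f] is a limit of functions that are constant on the cells of countable measurable
    partitions. *)
Lemma measurable_small_oscillation d (T : measurableType d) (R : realType) (f : T -> R) :
  (forall x : R, 0 < x -> exists r : T -> nat, (forall i, measurable (r @^-1` [set i])) /\
     forall z z', r z = r z' -> `|f z - f z'| <= x) ->
  measurable_fun setT f.
Proof.
move=> osc; have pos n : 0 < n.+1%:R^-1 :> R by rewrite invr_gt0.
pose r n := projT1 (cid (osc _ (pos n))).
have rP n : (forall i, measurable (r n @^-1` [set i])) /\
   forall z z', r n z = r n z' -> `|f z - f z'| <= n.+1%:R^-1.
  by rewrite /r; case: cid.
pose fn n z := fibre_value (r n) f (r n z).
apply: (@measurable_fun_cvg _ _ _ _ fn) => [n|z _].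
  move=> _ B mB; rewrite setTI.
  rewrite (_ : _ @^-1` _ = \bigcup_(i in [set i | B (fibre_value (r n) f i)]) (r n @^-1` [set i])).
    by apply: bigcup_measurable => i _; exact: (rP n).1.
  apply/seteqP; split=> [u Bu|u [i Bi ri]].
    by exists (r n u).
  by rewrite /= /fn ri.
apply/cvgrPdist_le => e e0; exists (Num.truncn e^-1) => // n /= en.
rewrite /fn; have [z' z'z ->] := fibre_valueP (r n) f z.
apply: le_trans ((rP n).2 _ _ (esym z'z)) _.
rewrite invf_ple ?posrE // ltW //.
by apply: lt_le_trans (truncnS_gt _) _; rewrite ler_nat.
Qed.

(** Combinations of the spanning family with coefficients that are integers over [m] are countable.
    Rounding coefficients down moves a vector by at most the sum of the norms of the [e i] over [m],
    less than [x]. Codes that decode to nothing are sent to 0. *)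
Lemma finite_dimensional_dense (R : realType) (V : normedModType R) (x : R) :
  finite_dimensional V -> 0 < x ->
  exists c : nat -> V, forall v, exists i, `|v - c i| < x.
Proof.
move=> [k [e Ve]] x0; pose s := \sum_(i < k) `|e i|.
have s0 : 0 <= s by exact: sumr_ge0.
pose m := (Num.truncn (s / x)).+1.
have m0 : 0 < m%:R :> R by rewrite ltr0n.
have sm : s / m%:R < x.
  by rewrite ltr_pdivrMr // mulrC -ltr_pdivrMr // truncnS_gt.
exists (fun n => if @unpickle {ffun 'I_k -> int} n is Some a
  then \sum_(i < k) ((a i)%:~R / m%:R) *: e i else 0) => v.
have [c ->] := Ve v.
exists (pickle [ffun i => Num.floor (c i * m%:R)]); rewrite pickleK.
apply: le_lt_trans sm; rewrite -sumrB; apply: le_trans (ler_norm_sum _ _ _) _.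
rewrite /s mulr_suml; apply: ler_sum => i _.
rewrite -scalerBl normrZ ffunE mulrC ler_wpM2l // ler_norml.
have := floor_itv (c i * m%:R); rewrite intrD => /andP[fl fu].
have -> : c i - (Num.floor (c i * m%:R))%:~R / m%:R =
    (c i * m%:R - (Num.floor (c i * m%:R))%:~R) / m%:R.
  by rewrite mulrBl mulfK // gt_eqF.
apply/andP; split.
  by apply: (@le_trans _ _ 0); [rewrite oppr_le0 invr_ge0 ltW|rewrite divr_ge0 ?subr_ge0 // ltW].
by rewrite ler_pdivrMr // mulVf ?gt_eqF //; lra.
Qed.

Section labelled_graphs.
Context (R : realType) (V : normedModType R) (d : measure_display) (Y : measurableType d).
Hypotheses (hV : finite_dimensional V) (hY : finite_discrete Y).

(** A cell collects the graphs with the same label and the same first point of the net at distance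
    less than [x / 2]. Its graphs form an open ball minus finitely many open balls, a Borel set, and
    every set of labels is measurable. *)
Lemma labelled_cells (x : R) : 0 < x ->
  exists r : labelled V Y -> nat, (forall i, measurable (r @^-1` [set i])) /\
    forall z z', r z = r z' -> z.2 = z'.2 /\ graph_dist z z' <= x.
Proof.
move=> x0; have x20 : 0 < x / 2 by rewrite divr_gt0.
have [c cP] := finite_dimensional_dense hV x20.
have [fY fY_inj] : exists fY : Y -> nat, {in [set: Y] &, injective fY}.
  by apply/countable_injP; exact/finite_set_countable/hY.1.
pose near n (z : labelled V Y) := `|(z.1 : V) - c n| < x / 2.
have nearP z : exists n, near n z by exact: cP.
pose first z := ex_minn (nearP z).
have mnear n : measurable [set z | near n z].
  rewrite (_ : mkset _ = fst @^-1` (ball (c n) (x / 2) : set (borel_space V))).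
    rewrite -[X in measurable X]setTI; apply: measurable_fst => //.
    by apply: sub_sigma_algebra; exact: ball_open.
  by apply/seteqP; split=> z; rewrite -ball_normE /near /= distrC.
exists (fun z => pickle (first z, fY z.2)); split=> [i|z z' /(pcan_inj pickleK)[zz' yy']].
  have [[z0 /= z0i]|none] := pselect (exists z, pickle (first z, fY z.2) = i); last first.
    rewrite (_ : _ @^-1` _ = set0); first exact: measurable0.
    by rewrite -subset0 => z /= zi; apply: none; exists z.
  rewrite (_ : _ @^-1` _ = ([set z | near (first z0) z] `&`
      \bigcap_(n in `I_(first z0)) ~` [set z | near n z]) `&` snd @^-1` [set y | fY y = fY z0.2]).
    apply: measurableI; first apply: measurableI; first exact: mnear.
      apply: fin_bigcap_measurable; first exact: finite_II.
      by move=> n _; exact/measurableC.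
    rewrite -[X in measurable X]setTI; apply: measurable_snd => //.
    exact: hY.2.
  apply/seteqP; split=> z /=.
    rewrite -z0i => /(pcan_inj pickleK)[<- ->]; split=> //.
    rewrite /first; case: ex_minnP => n nz nmin; split=> // m /= mn nm.
    by have := nmin _ nm; rewrite leqNgt mn.
  move=> [[z0z z0min] ->]; rewrite -z0i; congr (pickle (_, _)).
  rewrite {1}/first; case: ex_minnP => n nz nmin; apply/eqP.
  rewrite eqn_leq nmin //= leqNgt; apply/negP => n_lt.
  exact: (z0min n n_lt nz).
split; first by apply: fY_inj; rewrite ?inE.
have nz : near (first z) z by rewrite /first; case: ex_minnP.
have nz' : near (first z) z' by rewrite zz' /first; case: ex_minnP.
rewrite /graph_dist (le_trans (ler_distD (c (first z)) _ _)) //.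
move: nz nz'; rewrite /near (distrC _ (z'.1 : V)); lra.
Qed.

Lemma measurable_graph_dist (z : labelled V Y) :
  measurable_fun setT (fun z' => graph_dist z' z).
Proof.
apply: measurable_small_oscillation => x /labelled_cells[r [mr rx]].
exists r; split=> // u v /rx[_]; apply: le_trans.
by rewrite /graph_dist (le_trans (ler_dist_dist _ _)) // opprB addrA subrK.
Qed.

Context (O Theta : Type) (f : V -> Theta -> O) (l : O -> Y -> R).
Variable A : R.-pker (labelled V Y) ~> (labelled V Y).
Hypothesis hl : forall o y, 0 <= l o y <= 1.
Variable L : R.
Hypotheses (hL0 : 0 <= L) (hL : lipschitz_loss f l A L).

Lemma loss01 z t : 0 <= loss f l z t <= 1.
Proof. exact: hl. Qed.

Lemma loss_cells (x : R) : 0 < x ->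
  exists r : labelled V Y -> nat, (forall i, measurable (r @^-1` [set i])) /\
    forall t z z', r z = r z' -> `|loss f l z t - loss f l z' t| <= x.
Proof.
(* The denominator [L + 1] allows [L = 0]. Labels agree on a cell, so the first clause of
   [lipschitz_loss] applies. *)
move=> x0; have L1 : 0 < L + 1 by rewrite ltr_wpDl.
have [r [mr rx]] := labelled_cells (divr_gt0 x0 L1).
exists r; split=> // t z z' /rx[zy zz']; rewrite /loss zy.
have /= := hL.1 t z'.2 (z.1, z'.1) (conj I I) => /le_trans; apply.
apply: le_trans (ler_wpM2l hL0 zz') _.
by rewrite mulrCA ger_pMr // ler_pdivrMr // mul1r lerDl ler01.
Qed.

Lemma measurable_loss t : measurable_fun setT (loss f l ^~ t).
Proof.
apply: measurable_small_oscillation => x /loss_cells[r [mr rx]].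
by exists r; split=> // z z' /rx.
Qed.

(** The almost-everywhere clause of [lipschitz_loss], which covers augmentations that change the
    label, is integrated under [A z]. The bound is extended-real since the displacement may be
    infinite. *)
Lemma dist_loss_aug_le z t :
  (`|loss_aug f l A z t - loss f l z t|%:E <=
    L%:E * \int[A z]_z' (graph_dist z' z)%:E)%E.
Proof.
have Az1 := prob_kernel (s := A) z.
have mdiff : measurable_fun setT (fun z' => loss f l z' t - loss f l z t).
  by apply: measurable_funB => //; exact: measurable_loss.
have intl : (A z).-integrable setT (EFin \o (loss f l ^~ t)).
  by apply: unit_integrable => // z'; [exact: measurable_loss|exact: loss01].
have intc : (A z).-integrable setT (EFin \o cst (loss f l z t)).
  by apply: unit_integrable => // z'; exact: loss01.
have -> : loss_aug f l A z t - loss f l z t =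
    \int[A z]_z' (loss f l z' t - loss f l z t).
  rewrite RintegralB //; congr (_ - _).
  by rewrite (_ : (fun=> _) = cst (loss f l z t)) // Rintegral_cst // Az1 mulr1.
apply: le_trans (_ : \int[A z]_z' (`|loss f l z' t - loss f l z t|%:E) <= _)%E.
  rewrite EFin_normr_Rintegral //; last first.
    apply: (@bounded_integrable _ _ _ _ Az1 _ 1) => // z'.
    by rewrite ler_norml; have := loss01 z' t; have := loss01 z t; lra.
  by apply: le_abse_integral => //; exact/measurable_EFinP.
have mdist := measurable_graph_dist z.
rewrite -ge0_integralZl_EFin //; last 2 first.
- by move=> z' _; rewrite lee_fin normr_ge0.
- exact/measurable_EFinP.
apply: ae_ge0_le_integral => //.
- by apply/measurable_EFinP; exact: measurableT_comp.
- by move=> z' _; rewrite -EFinM lee_fin mulr_ge0 // normr_ge0.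
- by apply/measurable_EFinP; exact: measurable_funM.
- by apply: filterS (hL.2 t z) => z' H _; rewrite -EFinM lee_fin.
Qed.

Variable D : probability (labelled V Y) R.

Lemma measurable_loss_aug t : measurable_fun setT (loss_aug f l A ^~ t).
Proof. exact: (measurable_smoothed A loss01 measurable_loss). Qed.

Lemma loss_aug01 z t : 0 <= loss_aug f l A z t <= 1.
Proof. exact: (smoothed01 A loss01 measurable_loss). Qed.

Lemma dist_risk_le t :
  (`|risk f l D t - \int[D]_z loss_aug f l A z t|%:E <= L%:E * mean_displacement A D)%E.
Proof.
have D1 := probability_setT D.
have mdiff : measurable_fun setT (fun z => loss f l z t - loss_aug f l A z t).
  by apply: measurable_funB; [exact: measurable_loss|exact: measurable_loss_aug].
have mnorm : measurable_fun setT (fun z => `|loss f l z t - loss_aug f l A z t|).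
  exact: measurableT_comp.
rewrite /risk -RintegralB //; last 2 first.
- by apply: unit_integrable => // z; [exact: measurable_loss|exact: loss01].
- by apply: unit_integrable => // z; [exact: measurable_loss_aug|exact: loss_aug01].
apply: le_trans (_ : \int[D]_z (`|loss f l z t - loss_aug f l A z t|%:E) <= _)%E.
  rewrite EFin_normr_Rintegral //; last first.
    apply: (@bounded_integrable _ _ _ _ D1 _ 1) => // z.
    by rewrite ler_norml; have := loss01 z t; have := loss_aug01 z t; lra.
  by apply: le_abse_integral => //; exact/measurable_EFinP.
have dist_le z : (`|loss f l z t - loss_aug f l A z t|%:E <=
    L%:E * \int[A z]_z' (graph_dist z' z)%:E)%E.
  by rewrite distrC; exact: dist_loss_aug_le.
have dist0 z : (0 <= \int[A z]_z' (graph_dist z' z)%:E)%E.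
  by apply: integral_ge0 => z' _; rewrite lee_fin normr_ge0.
(* The factor [L] is moved to the measurable side as [L^-1], so that monotonicity alone compares the
   integrals. This requires [L] positive; for [L = 0] the two losses coincide pointwise. *)
move: hL0; rewrite le_eqVlt => /orP[/eqP L0|Lpos].
  rewrite -L0 mul0e (_ : (fun z => _) = cst 0%E) ?integral_cst0 ?integral0 //.
  apply/funext => z; apply/le_anti/andP; split; last by rewrite lee_fin.
  by have := dist_le z; rewrite -L0 mul0e.
have -> : (\int[D]_z (`|loss f l z t - loss_aug f l A z t|%:E) =
   L%:E * \int[D]_z (L^-1 * `|loss f l z t - loss_aug f l A z t|)%:E)%E.
  rewrite -ge0_integralZl_EFin //.
  - by apply: eq_integral => z _; rewrite -EFinM mulVKf // gt_eqF.
  - by move=> z _; rewrite lee_fin mulr_ge0 // invr_ge0.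
  - by apply/measurable_EFinP; exact: measurable_funM.
rewrite lee_wpmul2l ?lee_fin //; apply: ge0_le_integral_nonmeasurable => z.
  by rewrite lee_fin mulr_ge0 // invr_ge0.
by rewrite EFinM lee_pdivrMl //; exact: dist_le.
Qed.

End labelled_graphs.

(** This is [rademacher_le] with one constant for all [n], the maximum of the displacement bounds;
    when it is infinite the inequality is trivial. *)
Lemma rademacher_loss_aug_le (R : realType) (V : normedModType R)
  (hV : finite_dimensional V) (d : measure_display) (Y : measurableType d)
  (hY : finite_discrete Y) (O Theta : Type) (f : V -> Theta -> O)
  (l : O -> Y -> R) (hl : forall o y, 0 <= l o y <= 1)
  (A : R.-pker (labelled V Y) ~> (labelled V Y))
  (L : R) (hL0 : 0 <= L) (hL : lipschitz_loss f l A L)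
  (N : nat) (hN : (0 < N)%N) (z : 'I_N -> labelled V Y) :
  ((rademacher (loss_aug f l A) z)%:E <=
    (rademacher (loss f l) z)%:E
    + \big[maxe/0%E]_(n < N)
        (L%:E * \int[A (z n)]_z' (graph_dist z' (z n))%:E))%E.
Proof.
set B := \big[maxe/0%E]_(n < N) _.
have B0 : (0 <= B)%E by exact: bigmax_ge_id.
have [[t0 _]|T0] := pselect (exists t : Theta, True); last first.
  have rad0 (h : labelled V Y -> Theta -> R) : rademacher h z = 0.
    rewrite /rademacher big1 ?mulr0 // => e _.
    rewrite [X in sup X](_ : _ = set0) ?sup0 // -subset0 => x [t _ _].
    by apply: T0; exists t.
  by rewrite !rad0 add0e.
have BE n : (L%:E * \int[A (z n)]_z' (graph_dist z' (z n))%:E <= B)%E.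
  exact: (le_bigmax _ (fun n => L%:E * \int[A (z n)]_z' (graph_dist z' (z n))%:E)%E n).
have distB n t : (`|loss_aug f l A (z n) t - loss f l (z n) t|%:E <= B)%E.
  exact: le_trans (dist_loss_aug_le hV hY hl hL0 hL (z n) t) (BE n).
case: B B0 distB {BE} => [b B0 distB|_ _|//]; last by rewrite addey ?leey.
rewrite -EFinD lee_fin.
apply: le_trans (rademacher_le (z' := z) (c := fun=> b) t0 hN (loss01 f hl) _) _.
  by move=> n t; have := distB n t; rewrite lee_fin.
by rewrite lerD2l; exact: mean_le.
Qed.

Theorem theorem7p3p1 (R : realType) (V : normedModType R)
  (hV : finite_dimensional V)
  (d : measure_display) (Y : measurableType d) (hY : finite_discrete Y)
  (O Theta : Type) (f : V -> Theta -> O)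
  (l : O -> Y -> R) (hl : forall o y, 0 <= l o y <= 1)
  (A : R.-pker (labelled V Y) ~> (labelled V Y))
  (L : R) (hL0 : 0 <= L) (hL : lipschitz_loss f l A L)
  (D : probability (labelled V Y) R)
  (N : nat) (hN : (0 < N)%N)
  (delta : R) (hdelta : 0 < delta < 1) :
  (exists M0 : nat, (deterministic A -> M0 = 1%N) /\
    forall M : nat, (0 < M)%N -> (M0 <= M)%N ->
    forall (d' : measure_display) (Omega : measurableType d')
      (P : probability Omega R)
      (Z : 'I_N -> Omega -> labelled V Y)
      (Zt : 'I_N -> 'I_M -> Omega -> labelled V Y),
    augmented_sample A D P Z Zt ->
    with_probability P (1 - delta) (fun w =>
      forall theta_star theta_aug_hat : Theta,
        is_argmin (train_loss f l (fun n => Z n w)) theta_star ->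
        is_argmin (train_loss_aug f l (fun n m => Zt n m w)) theta_aug_hat ->
        ((risk f l D theta_aug_hat - risk f l D theta_star)%:E <=
          (2 * rademacher (loss_aug f l A) (fun n => Z n w)
           + 5 * Num.sqrt (2 * ln (4 / delta) / N%:R))%:E
          + (2 * L)%:E * mean_displacement A D)%E)) /\
  (forall z : 'I_N -> labelled V Y,
    ((rademacher (loss_aug f l A) z)%:E <=
      (rademacher (loss f l) z)%:E
      + \big[maxe/0%E]_(n < N)
          (L%:E * \int[A (z n)]_z' (graph_dist z' (z n))%:E))%E).
Proof.
split; last by move=> z; exact: (rademacher_loss_aug_le hV hY hl hL0 hL hN z).
(* Without parameters there are no minimizers to compare, and the sure event will do. *)
have [[t1 _]|T0] := pselect (exists t : Theta, True); last first.
  exists 1%N; split=> // M _ _ d' Omega P Z Zt _.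
  exists setT; split=> // [|w _ t]; last by exfalso; apply: T0; exists t.
  rewrite probability_setT lee_fin; case/andP: hdelta => delta0 _; lra.
have /andP[delta0 delta1] := hdelta.
have NR : 0 < N%:R :> R by rewrite ltr0n.
set unit := Num.sqrt (2 * ln (4 / delta) / N%:R).
have unit0 : 0 < unit.
  rewrite sqrtr_gt0 divr_gt0 // mulr_gt0 // ln_gt0 // ltr_pdivlMr //; lra.
(* Half of the fifth square root term pays for [t0] being only a near-minimizer of the risk, whose
   infimum need not be attained; the other half pays for the approximation error [eta]. *)
have eta0 : 0 < unit / 2 by rewrite divr_gt0.
have [t0 t0_min] : exists t0, forall t, risk f l D t0 <= risk f l D t + unit / 2.
  have risk_lb t : 0 <= risk f l D t.
    by apply: Rintegral_ge0 => z _; case/andP: (loss01 f hl z t).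
  have inf_risk : has_inf (range (risk f l D)).
    by split; [exists (risk f l D t1), t1|exists 0 => _ [t _ <-]].
  have [_ [t0 _ <-] t0_lt] := inf_adherent eta0 inf_risk.
  exists t0 => t; rewrite (le_trans (ltW t0_lt)) // lerD2r.
  by apply: ge_inf; [exact: inf_risk.2|exists t].
have [M0 [M0_det M0P]] := augmented_uniform_bound A D (loss01 f hl)
  (measurable_loss hV hY hL0 hL) (loss_cells hV hY hL0 hL) t0 hN hdelta eta0.
exists M0; split=> [A_det|M M_gt0 leM d' Omega P Z Zt [mZ mZt law]].
  apply: M0_det => C z mC; have [a Aa] := A_det z.
  rewrite /kmass Aa // diracE; case: (a \in C) => /=; first by rewrite subrr mulr0.
  by rewrite mul0r.
apply: with_probabilityC (M0P M M_gt0 leM d' Omega P Z Zt mZ mZt law) _.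
move=> w good ts ta _ ta_min.
have gap : (\int[D]_z loss_aug f l A z ta) - \int[D]_z loss_aug f l A z t0 <=
    2 * rademacher (loss_aug f l A) (fun n => Z n w) +
    4 * Num.sqrt (2 * ln (delta / 2)^-1 / N%:R) + unit / 2.
  rewrite leNgt; apply/negP => gap; apply: good; exists ta; split=> //.
  exact: ta_min.
have sqrt_le : Num.sqrt (2 * ln (delta / 2)^-1 / N%:R) <= unit.
  rewrite ler_wsqrtr // ler_pM2r ?invr_gt0 // ler_pM2l //.
  by rewrite invf_div ler_ln ?posrE ?divr_gt0 // ler_pM2r ?invr_gt0 // ler_nat.
(* At each of [ta] and [t0], passing between the risk and the augmented risk costs [L] times the
   mean displacement, hence the factor [2 * L]; near-minimality then compares [t0] with [ts]. *)
move: gap sqrt_le (t0_min ts) (dist_risk_le hV hY hl hL0 hL D ta)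
  (dist_risk_le hV hY hl hL0 hL D t0).
move: (risk f l D ta) (risk f l D ts) (risk f l D t0) => ra rs r0.
move: (\int[D]_z loss_aug f l A z ta) (\int[D]_z loss_aug f l A z t0) => ea e0.
move: (rademacher _ _) (Num.sqrt (2 * ln (delta / 2)^-1 / N%:R)) => rad sq.
rewrite -/unit (EFinM 2) -muleA; move: unit {unit0 eta0 t0_min M0P good} => unit.
move: (L%:E * mean_displacement A D)%E => [x| |] gap sqrt_le.
- by rewrite -EFinM -EFinD !lee_fin !ler_norml; lra.
- by rewrite gt0_muley ?lte_fin // addey ?leey.
- by [].
Qed.
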